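(* Let $\mu$ be a permuton. Suppose there exists $0\le y\le1$ such that $\mu$ admits a continuous, positive density $\rho$ on a neighborhood (in $[0,1]^2$) of the point $(0,y)$. For each $n$, let $\mathcal P^N_\mu$ be a Poisson point process on $[0,1]^2$ with intensity $n\mu$. Let $c^*$ be the unique solution $c\ge2$ of $c\log(2e/c)=1$. Then for any $\varepsilon>0$, $$\lim_{n\to\infty}\mathbb P\left[\frac{h\left(\mathcal T\langle\mathcal P^N_\mu\rangle\right)}{c^*\log n}\le1-\varepsilon\right]=0 .$$
   Context: A permuton is a probability measure $\mu$ on $[0,1]^2$ with uniform marginals: $\mu(A\times[0,1])=\mu([0,1]\times A)=\mathrm{Leb}(A)$. Binary search trees: for a finite sequence $y=(y_1,\dots,y_n)$ of distinct reals, $\mathcal T\langle y\rangle$ is the labeled rooted binary tree obtained by inserting $y_1,\dots,y_n$ successively into the empty tree: to insert a value, start at the root, move to the left child if the value is smaller than the label of the current node and to the right child if it is larger, until an empty position is reached, where a new node with this label is created. For a finite set $\mathcal P\subset\mathbb R^2$ of points with distinct $x$- and distinct $y$-coordinates, $\mathcal T\langle\mathcal P\rangle:=\mathcal T\langle y_{(1)},\dots,y_{(n)}\rangle$, where the points $(x_{(i)},y_{(i)})$ of $\mathcal P$ are ordered so that $x_{(1)}<\dots<x_{(n)}$. The height $h(\mathcal T)$ is the maximal distance (number of edges) from a leaf to the root; the empty tree is given height $0$ by convention. *)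

(* Defs.v *)
From HB Require Import structures.
From mathcomp Require Import all_boot all_order all_algebra finmap.
From mathcomp Require Import all_classical all_reals all_analysis.

Set Implicit Arguments.
Unset Strict Implicit.
Unset Printing Implicit Defensive.

Import Order.TTheory GRing.Theory Num.Theory.
Import numFieldNormedType.Exports.

Local Open Scope classical_set_scope.
Local Open Scope ring_scope.

(** ** Binary search trees *)

Inductive btree (T : Type) : Type :=
| BEmpty
| BNode of btree T & T & btree T.
Arguments BEmpty {T}.

(* Labels are meant to be distinct; a repeated label would go to the right. *)
Fixpoint bst_insert {R : realType} (v : R) (t : btree R) : btree R :=
  match t with
  | BEmpty => BNode BEmpty v BEmpty
  | BNode l u r =>
      if v < u then BNode (bst_insert v l) u r else BNode l u (bst_insert v r)
  end.

Definition bst_of_seq {R : realType} (s : seq R) : btree R :=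
  foldl (fun t v => bst_insert v t) BEmpty s.

(* Ordering the points lexicographically is ordering them by first coordinate
   as soon as the first coordinates are distinct.  For other configurations it
   makes the tree a function of the set of points that does not depend on the
   enumeration underlying [{fset R * R}]. *)
Definition lexi_le {R : realType} : rel (R * R) :=
  fun p q => (p.1 < q.1) || (p.1 == q.1) && (p.2 <= q.2).

Definition bst_of_points {R : realType} (X : {fset R * R}) : btree R :=
  bst_of_seq [seq p.2 | p <- sort lexi_le X].

(* The distances (in edges) from the leaves of [t] to its root. *)
Fixpoint leaf_depths {T : Type} (t : btree T) : seq nat :=
  match t with
  | BEmpty => [::]
  | BNode BEmpty _ BEmpty => [:: 0%N]
  | BNode l _ r => [seq d.+1 | d <- leaf_depths l ++ leaf_depths r]
  end.

(* An empty maximum is 0, so the empty tree has height 0. *)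
Definition height {T : Type} (t : btree T) : nat :=
  (\max_(d <- leaf_depths t) d)%N.

(** ** Permutons *)

Definition unit_square (R : realType) : set (R * R) := `[0, 1] `*` `[0, 1].
Arguments unit_square : clear implicits.

(* The case [A = `[0, 1]] says that [mu] is carried by the unit square. *)
Definition permuton {R : realType} (mu : probability (R * R)%type R) : Prop :=
  forall A : set R, measurable A -> A `<=` `[0, 1] ->
    mu (A `*` `[0, 1]) = lebesgue_measure A /\
    mu (`[0, 1] `*` A) = lebesgue_measure A.

(* Neighborhoods are taken in the subspace topology of the unit square. *)
Definition has_continuous_positive_density_near {R : realType}
    (mu : probability (R * R)%type R) (p : R * R) : Prop :=
  exists (U : set (R * R)) (rho : R * R -> R),
    [/\ U `<=` unit_square R,
        within (unit_square R) (nbhs p) U,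
        {within U, continuous rho},
        (forall q, U q -> 0 < rho q)
      & forall A : set (R * R), measurable A -> A `<=` U ->
          mu A = (\int[lebesgue_measure \x lebesgue_measure]_(q in A)
                    (rho q)%:E)%E].

(** ** Poisson point processes *)

Definition npoints {R : realType} (X : {fset R * R}) (A : set (R * R)) : nat :=
  size [seq p <- X | p \in A].

(* [pts] is a Poisson point process on [S] with finite intensity measure
   [Lambda].  The second argument of [poisson_prob] is unused in its
   definition; [poisson_prob 0] is the Dirac mass at 0. *)
Definition poisson_point_process {R : realType} {d : measure_display}
    {Omega : measurableType d} (P : probability Omega R)
    (S : set (R * R)) (Lambda : {finite_measure set (R * R)%type -> \bar R})
    (pts : Omega -> {fset R * R}) : Prop :=
  [/\ forall w p, p \in pts w -> S p,
      forall A : set (R * R), measurable A ->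
        measurable_fun setT (fun w => npoints (pts w) A),
      forall A : set (R * R), measurable A -> A `<=` S ->
        forall B : set nat,
          P [set w | B (npoints (pts w) A)] =
          poisson_prob (fine (Lambda A)) 0 B
    & forall (m : nat) (A : 'I_m -> set (R * R)) (B : 'I_m -> set nat),
        (forall i, measurable (A i) /\ A i `<=` S) ->
        trivIset setT A ->
        P [set w | forall i, B i (npoints (pts w) (A i))] =
        (\prod_(i < m) P [set w | B i (npoints (pts w) (A i))])%E].

(* Main.v *)
Require Import Defs.
From HB Require Import structures.
From mathcomp Require Import all_boot all_order all_algebra finmap.
From mathcomp Require Import all_classical all_reals all_analysis.
From mathcomp Require Import zify ring lra.

Set Implicit Arguments.
Unset Strict Implicit.

Import Order.TTheory GRing.Theory Num.Theory.
Import numFieldNormedType.Exports.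

Local Open Scope classical_set_scope.
Local Open Scope ring_scope.

(** While no point falls in a horizontal strip, all values of the strip follow
    the same path in the tree, and the next point of the strip lengthens this
    path.  Near (0, y) the points are almost uniform, so a strip behaves like a
    gap that is split repeatedly at uniform places.

    Take a strip with [b] cells and watch it for a time during which each cell
    receives about one point.  The mean number of cells that stay vacant and
    whose surrounding gap has been split [l] times is about
    [(2 log b)^l / (l! b)], which is large for some [b] and [l] with [l / log b]
    as close to [c] as wished.  These cells are disjoint strips to which the
    argument applies again on a time scale [b] times longer, which gives a
    supercritical branching process; it can be run for about [log n / log b]
    generations, hence reaches depth about [c log n] with a probability bounded
    below.  Independent copies of it in [m] disjoint strips next to (0, y) make
    the probability of failure at most [q ^ m] for a fixed [q < 1].

    Time and space are discretized so that only the probabilities that finitely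
    many disjoint rectangles are void enter the argument. *)

(** * Insertion paths in binary search trees *)

(** By Stirling, [(2 log b)^l / (l! b)] with [l = x log b] is [b ^ (x log (2e/x) - 1)] up to a power
    of [log b]. For [x >= 2] the exponent decreases in [x] and vanishes at [x = c]; hence the
    constant, and some room at any ratio slightly below [c]. This room pays for all losses:
    intensities are known only up to a factor [kap], rows with two points in the current gap are
    discarded, and small gaps are given up. The cells of one block are strongly dependent, but a
    first moment suffices. The number [Z] of deep cells is at most [b], and the blocks that start in
    them read fresh sites; if each survives with probability at least [1/b], the whole survives with
    probability at least [E[1 - (1 - 1/b)^Z] >= E[Z] / (2b)], which is at least [1/b] again once
    [E[Z] >= 2]. The density is used only in a fixed box next to (0, y): generation [i] lasts a time
    of order [b^i / n], so about [log n / log b] generations fit in before a constant time. *)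

Fixpoint insertion_depth {R : realType} (v : R) (t : btree R) : nat :=
  if t is BNode l u r then
    (if v < u then insertion_depth v l else insertion_depth v r).+1
  else 0%N.

Fixpoint btree_labels {T : Type} (t : btree T) : seq T :=
  if t is BNode l u r then btree_labels l ++ u :: btree_labels r else [::].

Lemma mem_bst_insert {R : realType} (v x : R) (t : btree R) :
  x \in btree_labels (bst_insert v t) = (x == v) || (x \in btree_labels t).
Proof.
elim: t => [|l IHl u r IHr] //=.
case: ifP => _ /=; rewrite !(mem_cat, inE) ?IHl ?IHr /=.
  by rewrite !orbA.
by case: (x == v); rewrite ?orbT.
Qed.

Lemma mem_bst_of_seq {R : realType} (x : R) (s : seq R) :
  x \in btree_labels (bst_of_seq s) = (x \in s).
Proof.
elim/last_ind: s => [|s v IH] //.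
by rewrite /bst_of_seq foldl_rcons mem_bst_insert mem_rcons inE -IH.
Qed.

Lemma insertion_depth_le_insert {R : realType} (v w : R) (t : btree R) :
  (insertion_depth v t <= insertion_depth v (bst_insert w t))%N.
Proof.
elim: t => [|l IHl u r IHr] //=.
by case: (ltP w u) => _ /=; case: (ltP v u) => _; rewrite ?ltnS.
Qed.

(** [v] and [w] compare alike with every label, so they follow the same path, and [w] is placed
    exactly where [v] would have been. *)
Lemma insertion_depth_insert {R : realType} (v w : R) (t : btree R) :
  {in btree_labels t, forall u, (v < u) = (w < u)} ->
  insertion_depth v (bst_insert w t) = (insertion_depth v t).+1.
Proof.
elim: t => [_|l IHl u r IHr lab] /=; first by case: ifP.
have -> : (w < u) = (v < u) by rewrite lab// mem_cat inE eqxx orbT.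
case: ifP => vu /=; rewrite vu ?IHl ?IHr // => x xin; apply: lab.
  by rewrite mem_cat xin.
by rewrite mem_cat inE xin !orbT.
Qed.

(** The definition singles out the one-node tree by matching on empty children; testing the list of
    leaves is equivalent because a nonempty tree has a leaf. *)
Lemma leaf_depths_node {T : Type} (l r : btree T) (u : T) :
  leaf_depths (BNode l u r) =
  if leaf_depths l ++ leaf_depths r is [::] then [:: 0%N]
  else [seq d.+1 | d <- leaf_depths l ++ leaf_depths r].
Proof.
have ne (t : btree T) : t <> BEmpty -> (0 < size (leaf_depths t))%N.
  elim: t => // l' IHl u' r' IHr _.
  have [->|l0] := pselect (l' = BEmpty).
    have [->|r0] := pselect (r' = BEmpty); first by [].
    rewrite (_ : leaf_depths _ = [seq d.+1 | d <- leaf_depths r']).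
      by rewrite size_map IHr.
    by case: r' r0 {IHr}.
  rewrite (_ : leaf_depths _ =
               [seq d.+1 | d <- leaf_depths l' ++ leaf_depths r']).
    by rewrite size_map size_cat ltn_addr// IHl.
  by case: l' l0 {IHl}.
have [->|l0] := pselect (l = BEmpty).
  have [->|r0] := pselect (r = BEmpty); first by [].
  rewrite (_ : leaf_depths (BNode _ _ _) = [seq d.+1 | d <- leaf_depths r]).
    by rewrite cat0s; have := ne _ r0; case: leaf_depths.
  by case: r r0.
rewrite (_ : leaf_depths (BNode _ _ _) =
             [seq d.+1 | d <- leaf_depths l ++ leaf_depths r]).
  by have := ne _ l0; case: (leaf_depths l).
by case: l l0.
Qed.

(** In a nonempty tree the path of [v] ends just below a node, and some leaf lies at or below that
    node: hence the successor. *)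
Lemma insertion_depth_le_height {R : realType} (v : R) (t : btree R) :
  (insertion_depth v t <= (height t).+1)%N.
Proof.
have hS (l r : btree R) u t' : leaf_depths t' != [::] ->
    (forall d, d \in leaf_depths t' -> d.+1 \in leaf_depths (BNode l u r)) ->
    ((height t').+1 <= height (BNode l u r))%N.
  rewrite /height => t'0 sub.
  have [d dt ->] : exists2 d, d \in leaf_depths t' &
      (\max_(d <- leaf_depths t') d = d)%N.
    elim: (leaf_depths t') t'0 => // a s IH _.
    rewrite big_cons; case: s IH => [|b s] IH.
      by rewrite big_nil maxn0; exists a; rewrite ?mem_head.
    have [//|d ds ->] := IH; rewrite /maxn; case: ifP => _.
      by exists d; rewrite // inE ds orbT.
    by exists a; rewrite ?mem_head.
  by rewrite (big_rem _ (sub _ dt)) /= leq_maxl.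
have d0 (t' : btree R) : leaf_depths t' = [::] -> insertion_depth v t' = 0%N.
  case: t' => // l u r; rewrite leaf_depths_node.
  by case: (_ ++ _).
elim: t => [|l IHl u r IHr] //.
rewrite /= ltnS; case: ifP => _.
  have [/eqP l0|l0] := boolP (leaf_depths l == [::]).
    by rewrite d0.
  apply: (leq_trans IHl); apply: hS => // d dl; rewrite leaf_depths_node.
  case E : (leaf_depths l ++ leaf_depths r) => [|a s].
    by case: (leaf_depths l) E l0.
  by rewrite -E mem_map ?mem_cat ?dl//; exact: succn_inj.
have [/eqP l0|l0] := boolP (leaf_depths r == [::]).
  by rewrite d0.
apply: (leq_trans IHr); apply: hS => // d dl; rewrite leaf_depths_node.
case E : (leaf_depths l ++ leaf_depths r) => [|a s].
  by case: (leaf_depths l) E => //; case: (leaf_depths r) l0.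
by rewrite -E mem_map ?mem_cat ?dl ?orbT//; exact: succn_inj.
Qed.

Lemma insertion_depth_cat {R : realType} (v : R) (s1 s2 : seq R) :
  (insertion_depth v (bst_of_seq s1) <=
   insertion_depth v (bst_of_seq (s1 ++ s2)))%N.
Proof.
elim/last_ind: s2 => [|s2 w IH]; first by rewrite cats0.
rewrite -rcons_cat {2}/bst_of_seq foldl_rcons.
exact: leq_trans IH (insertion_depth_le_insert _ _ _).
Qed.

(* As long as no label lies in [lo, hi[, the insertion path is the same for all
   values of [lo, hi[: the first label falling there ends up on the path of
   [v]. *)
Lemma insertion_depth_cat_itv {R : realType} (lo hi v : R) (s1 s2 : seq R) :
  lo <= v < hi -> {in s1, forall u, ~~ (lo <= u < hi)} ->
  (exists2 p, p \in s2 & lo <= p < hi) ->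
  (insertion_depth v (bst_of_seq s1) <
   insertion_depth v (bst_of_seq (s1 ++ s2)))%N.
Proof.
move=> vI; elim: s2 s1 => [s1 _ []//|p s2 IH s1 s1I [q]].
rewrite -cat_rcons inE; have [pI _ _|pI] := boolP (lo <= p < hi).
  apply: leq_trans (insertion_depth_cat _ _ _).
  rewrite {2}/bst_of_seq foldl_rcons insertion_depth_insert// => u.
  rewrite mem_bst_of_seq => /s1I; move: vI pI => /andP[? ?] /andP[? ?].
  rewrite negb_and -ltNge -leNgt => /orP[?|?].
    by apply/idP/idP; lra.
  by apply/idP/idP; lra.
move=> /orP[/eqP->|qs2] qI; first by rewrite qI in pI.
apply: leq_ltn_trans (IH (rcons s1 p) _ _).
- by rewrite -cats1 insertion_depth_cat.
- by move=> u; rewrite mem_rcons inE => /orP[/eqP->|/s1I].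
- by exists q.
Qed.

(** * Independent sites and the branching recursion *)

(* [bernoulli_mean L phi] is the expectation of [phi] applied to the list of
   the states of independent sites, where site [i] is vacant ([false]) with
   probability [L`_i]. *)
Fixpoint bernoulli_mean {R : realFieldType} (L : seq R) (phi : seq bool -> R) : R :=
  if L is p :: L' then
    p * bernoulli_mean L' (fun x => phi (false :: x)) +
    (1 - p) * bernoulli_mean L' (fun x => phi (true :: x))
  else phi [::].

Section bernoulli_mean.
Context {R : realFieldType}.
Implicit Types (L : seq R) (phi psi : seq bool -> R).

Lemma bernoulli_mean_eq L phi psi :
  (forall x, size x = size L -> phi x = psi x) ->
  bernoulli_mean L phi = bernoulli_mean L psi.
Proof.
elim: L phi psi => [|p L IH] phi psi /= eq; first exact: eq.
by congr (_ * _ + _ * _); apply: IH => x sx; apply: eq; rewrite /= sx.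
Qed.

Lemma bernoulli_mean_le L phi psi : all (fun p => 0 <= p <= 1) L ->
  (forall x, size x = size L -> phi x <= psi x) ->
  bernoulli_mean L phi <= bernoulli_mean L psi.
Proof.
elim: L phi psi => [|p L IH] phi psi /=; first by move=> _; exact.
move=> /andP[/andP[p0 p1] L01] le.
by apply: lerD; apply: ler_wpM2l; rewrite ?subr_ge0//; apply: IH => // x sx;
  apply: le; rewrite /= sx.
Qed.

Lemma bernoulli_mean_cst L (k : R) : bernoulli_mean L (fun=> k) = k.
Proof. by elim: L => //= p L ->; ring. Qed.

Lemma bernoulli_mean_cat L1 L2 phi : bernoulli_mean (L1 ++ L2) phi =
  bernoulli_mean L1 (fun x => bernoulli_mean L2 (fun y => phi (x ++ y))).
Proof. by elim: L1 phi => //= p L1 IH phi; rewrite !IH. Qed.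

Lemma bernoulli_meanD L phi psi :
  bernoulli_mean L (fun x => phi x + psi x) =
  bernoulli_mean L phi + bernoulli_mean L psi.
Proof. by elim: L phi psi => //= p L IH phi psi; rewrite !IH; ring. Qed.

Lemma bernoulli_meanZ L (k : R) phi :
  bernoulli_mean L (fun x => k * phi x) = k * bernoulli_mean L phi.
Proof. by elim: L phi => //= p L IH phi; rewrite !IH; ring. Qed.

Lemma bernoulli_mean_sum L (I : Type) (r : seq I) (F : I -> seq bool -> R) :
  bernoulli_mean L (fun x => \sum_(i <- r) F i x) =
  \sum_(i <- r) bernoulli_mean L (F i).
Proof.
elim: r => [|i r IH].
  rewrite big_nil -[RHS](bernoulli_mean_cst L); apply: bernoulli_mean_eq => x _.
  by rewrite big_nil.
rewrite big_cons -IH -bernoulli_meanD; apply: bernoulli_mean_eq => x _.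
by rewrite big_cons.
Qed.

Lemma bernoulli_mean_ge0 L phi : all (fun p => 0 <= p <= 1) L ->
  (forall x, 0 <= phi x) -> 0 <= bernoulli_mean L phi.
Proof.
by move=> L01 ge0; rewrite -(bernoulli_mean_cst L 0); exact: bernoulli_mean_le.
Qed.

Lemma bernoulli_mean_prod L (F : nat -> bool -> R) :
  bernoulli_mean L (fun x => \prod_(i < size L) F i (nth false x i)) =
  \prod_(i < size L) (L`_i * F i false + (1 - L`_i) * F i true).
Proof.
elim: L F => [|p L IH] F /=; first by rewrite !big_ord0.
have e s : bernoulli_mean L (fun x =>
      \prod_(i < (size L).+1) F i (nth false (s :: x) i)) =
    F 0%N s * \prod_(i < size L) (L`_i * F i.+1 false + (1 - L`_i) * F i.+1 true).
  rewrite -(IH (fun i => F i.+1)) -bernoulli_meanZ.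
  by apply: bernoulli_mean_eq => x _; rewrite big_ord_recl.
by rewrite !e big_ord_recl /=; ring.
Qed.

Lemma bernoulli_mean_flatten (Ls : seq (seq R)) (F : nat -> seq bool -> R) :
  bernoulli_mean (flatten Ls) (fun x =>
    \prod_(j < size Ls) F j (nth [::] (reshape (shape Ls) x) j)) =
  \prod_(j < size Ls) bernoulli_mean (nth [::] Ls j) (F j).
Proof.
elim: Ls F => [|L Ls IH] F /=; first by rewrite !big_ord0.
rewrite bernoulli_mean_cat big_ord_recl /=.
rewrite (_ : \prod_(i < size Ls) _ =
  \prod_(j < size Ls) bernoulli_mean (nth [::] Ls j) (F j.+1))//.
rewrite -(IH (fun j => F j.+1)) mulrC -bernoulli_meanZ.
apply: bernoulli_mean_eq => x sx; rewrite mulrC -bernoulli_meanZ.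
apply: bernoulli_mean_eq => y _; rewrite big_ord_recl /=.
by rewrite take_size_cat// drop_size_cat.
Qed.

End bernoulli_mean.

Definition vacant (lo hi : nat) (x : seq bool) : bool :=
  all (fun i => ~~ nth false x i) (iota lo (hi - lo)).

Definition only_occupied (lo hi u : nat) (x : seq bool) : bool :=
  all (fun i => nth false x i == (i == u)) (iota lo (hi - lo)).

(* The sites [x] form [t] successive rows of [b] sites.  A gap starts as
   [lo, hi[ and shrinks to one side of the first occupied site that appears in
   it; [deep_cell] holds if cell [j] stays vacant and the gap containing it
   shrinks at least [k] times, no two sites of the current gap being ever
   occupied in the same row before the [k]-th time. *)
Fixpoint deep_cell (b t k lo hi j : nat) (x : seq bool) : bool :=
  if t is t'.+1 then
    let y := drop b x in
    if k is k'.+1 then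
      (vacant lo hi x && deep_cell b t' k lo hi j y) ||
      has (fun u => only_occupied lo hi u x &&
          ((j < u)%N && deep_cell b t' k' lo u j y ||
           (u < j)%N && deep_cell b t' k' u.+1 hi j y)) (iota lo (hi - lo))
    else ~~ nth false x j && deep_cell b t' 0 lo hi j y
  else k == 0%N.

(** * First moment of the number of deep cells *)

Section first_moment.
Context {R : realFieldType}.
Variables (a q : R) (b : nat).
Hypotheses (a0 : 0 <= a) (a1 : a <= 1) (q0 : 0 <= q).

(** Meant for Poisson counts of mean between [kap * lam] and [lam], with [a = expR (- lam)] and
    [q = kap * lam]. Bounding occupation by [q * a] gives a gap with one prescribed occupied site
    the same power of [a] as a vacant gap. *)
Definition admissible : pred (seq R) :=
  all (fun p => (a <= p <= 1) && (q * a <= 1 - p)).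

Lemma admissible01 L : admissible L -> all (fun p => 0 <= p <= 1) L.
Proof. by apply: sub_all => p /andP[/andP[ap ->] _]; rewrite (le_trans a0). Qed.

Lemma admissible_nth L i : admissible L -> (i < size L)%N ->
  a <= L`_i <= 1 /\ q * a <= 1 - L`_i.
Proof. by move=> /(all_nthP 0) adm /adm /andP[]. Qed.

Lemma prod_if_itv (lo hi n : nat) (z : R) : (lo <= hi <= n)%N ->
  \prod_(i < n) (if (lo <= i < hi)%N then z else 1) = z ^+ (hi - lo).
Proof.
move=> /andP[lohi hin].
rewrite -(big_mkord xpredT (fun i => if (lo <= i < hi)%N then z else 1)).
rewrite (@big_cat_nat _ _ _ lo)//=; last exact: leq_trans hin.
rewrite big_nat big1 ?mul1r; last by move=> i /andP[_ ilo]; rewrite leqNgt ilo.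
rewrite (@big_cat_nat _ _ _ hi)//= [X in _ * X]big_nat [X in _ * X]big1 ?mulr1.
  by rewrite big_nat (eq_bigr (fun=> z)) -?big_nat ?prodr_const_nat// => i ->.
by move=> i /andP[hii _]; rewrite ltnNge hii andbF.
Qed.

Lemma mean_vacant L lo hi : admissible L -> (lo <= hi <= size L)%N ->
  a ^+ (hi - lo) <= bernoulli_mean L (fun x => (vacant lo hi x)%:R).
Proof.
move=> adm lohi.
(* The indicator becomes a product over all sites, with trivial factors outside of the gap, so that
   [bernoulli_mean_prod] applies. *)
pose F i (s : bool) : R := if (lo <= i < hi)%N then (~~ s)%:R else 1.
apply: (@le_trans _ _ (bernoulli_mean L
    (fun x => \prod_(i < size L) F i (nth false x i)))).
  rewrite bernoulli_mean_prod -(prod_if_itv a lohi); apply: ler_prod => i _.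
  have [/andP[ai _] _] := admissible_nth adm (ltn_ord i).
  by rewrite /F; case: ifP => _ //=; rewrite ?a0 ?ler01 /= ?mulr1 ?mulr0 ?addr0//;
    lra.
apply: bernoulli_mean_le (admissible01 adm) _ => x sx.
have [v|/allPn[i]] := boolP (vacant lo hi x).
  apply: prodr_ile1 => i _; rewrite /F; case: ifP => _; last by rewrite ler01 lexx.
  by case: nth; rewrite ?ler01 lexx.
rewrite mem_iota subnKC; last by case/andP: lohi.
move=> ilohi; rewrite negbK => xi.
have iL : (i < size L)%N by lia.
by rewrite (bigD1 (Ordinal iL))//= /F ilohi xi mul0r.
Qed.

Lemma mean_only_occupied L lo hi u :
  admissible L -> (hi <= size L)%N -> (lo <= u < hi)%N ->
  q * a ^+ (hi - lo) <=
  bernoulli_mean L (fun x => (only_occupied lo hi u x)%:R).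
Proof.
move=> adm hiL uI; have lohi : (lo <= hi <= size L)%N by lia.
have uL : (u < size L)%N by lia.
pose F i (s : bool) : R := if (lo <= i < hi)%N then (s == (i == u))%:R else 1.
apply: (@le_trans _ _ (bernoulli_mean L
    (fun x => \prod_(i < size L) F i (nth false x i)))).
  rewrite bernoulli_mean_prod -(prod_if_itv a lohi).
  have {1}-> : q = \prod_(i < size L) if i == Ordinal uL then q else 1.
    by rewrite -big_mkcond big_pred1_eq.
  rewrite -big_split /=; apply: ler_prod => i _.
  have [/andP[ai _] qi] := admissible_nth adm (ltn_ord i).
  rewrite -val_eqE /F /=; have [iu|iu] := eqVneq (i : nat) u.
    by rewrite iu uI /= mulr0 add0r mulr1 mulr_ge0//= -iu.
  by case: ifP => _ /=; rewrite mul1r ?a0 ?ler01 /= ?mulr1 ?mulr0 ?addr0//; lra.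
apply: bernoulli_mean_le (admissible01 adm) _ => x sx.
have [v|/allPn[i]] := boolP (only_occupied lo hi u x).
  apply: prodr_ile1 => i _; rewrite /F; case: ifP => _; last by rewrite ler01 lexx.
  by case: eqP; rewrite ?ler01 lexx.
rewrite mem_iota subnKC; last by case/andP: lohi.
move=> ilohi /negbTE xi.
have iL : (i < size L)%N by lia.
by rewrite (bigD1 (Ordinal iL))//= /F ilohi xi mul0r.
Qed.

(* Only one of the alternatives defining [deep_cell] can occur. *)
Lemma deep_cell_ge t k lo hi j (x : seq bool) :
  (vacant lo hi x)%:R * (deep_cell b t k.+1 lo hi j (drop b x))%:R +
  \sum_(lo <= u < hi) (only_occupied lo hi u x)%:R *
    ((j < u)%N%:R * (deep_cell b t k lo u j (drop b x))%:R +
     (u < j)%N%:R * (deep_cell b t k u.+1 hi j (drop b x))%:R) <=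
  (deep_cell b t.+1 k.+1 lo hi j x)%:R :> R.
Proof.
have le1 (c : bool) : c%:R <= 1 :> R by case: c; rewrite ?ler01.
have [v|nv] := boolP (vacant lo hi x).
  rewrite big_nat big1 => [|u lohi].
    by rewrite addr0 mul1r /= v /=; case: deep_cell; rewrite //= ler0n.
  have -> : only_occupied lo hi u x = false.
    apply/negbTE/allPn; exists u; first by rewrite mem_iota; lia.
    move/allP: v => /(_ u); rewrite mem_iota eqxx eqb_id; apply; lia.
  by rewrite mul0r.
rewrite mul0r add0r.
have [/hasP[u]|/hasPn none] :=
    boolP (has (only_occupied lo hi ^~ x) (iota lo (hi - lo))).
  rewrite mem_iota => uI oc.
  rewrite (bigD1_seq u) ?mem_index_iota ?iota_uniq//=; last lia.
  rewrite [X in _ + X]big_nat_cond [X in _ + X]big1 => [|i /andP[iI iu]].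
    rewrite addr0 oc mul1r.
    have le (d1 d2 d : bool) : (d1 || d2 -> d) -> ~~ (d1 && d2) ->
        d1%:R + d2%:R <= d%:R :> R.
      by case: d1; case: d2; case: d => //= h _;
        rewrite ?addr0 ?add0r ?ler01 //; have := h isT.
    rewrite -!natrM !mulnb; apply: le; last first.
      by apply/negP => /andP[/andP[? _] /andP[? _]]; lia.
    move=> h; rewrite /= (negbTE nv) /=; apply/hasP; exists u.
      by rewrite mem_iota.
    by rewrite oc.
  have -> : only_occupied lo hi i x = false; last by rewrite mul0r.
  apply/negbTE/allPn; exists i; first by rewrite mem_iota; lia.
  rewrite eqxx eqb_id; move/allP: oc => /(_ i); rewrite mem_iota (negbTE iu).
  by rewrite eqbF_neg; apply; lia.
rewrite big_nat big1 ?ler0n// => u uI.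
have /none/negbTE-> : u \in iota lo (hi - lo) by rewrite mem_iota; lia.
by rewrite mul0r.
Qed.

Lemma mean_stay_vacant t lo hi j L : (j < b)%N -> size L = (t * b)%N ->
  admissible L ->
  a ^+ t <= bernoulli_mean L (fun x => (deep_cell b t 0 lo hi j x)%:R).
Proof.
move=> jb; elim: t L => [|t IH] L.
  by rewrite mul0n => /size0nil-> _.
rewrite mulSn => sL adm.
have bL : (b <= size L)%N by rewrite sL leq_addr.
move: adm; rewrite -(cat_take_drop b L) /admissible all_cat => /andP[].
move: (size_takel bL) (size_drop b L); rewrite sL addKn.
set L1 := take b L; set L2 := drop b L => sL1 sL2 adm1 adm2.
rewrite bernoulli_mean_cat exprSr.
apply: (@le_trans _ _ (bernoulli_mean L1 (fun x =>
    bernoulli_mean L2 (fun y => (deep_cell b t 0 lo hi j y)%:R) *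
    (vacant j j.+1 x)%:R))).
  rewrite bernoulli_meanZ; apply: ler_pM; rewrite ?exprn_ge0//; first exact: IH.
  have := @mean_vacant L1 j j.+1 adm1; rewrite subSnn expr1; apply.
  by rewrite sL1; lia.
apply: bernoulli_mean_le (admissible01 adm1) _ => x sx.
rewrite mulrC -bernoulli_meanZ.
apply: bernoulli_mean_le (admissible01 adm2) _ => y _ /=.
rewrite drop_size_cat ?sx// nth_cat sx sL1 jb /vacant subSnn /= andbT.
by rewrite -natrM mulnb.
Qed.

(** A comparison principle, by conditioning on the first row of a gap of [m] cells: it is vacant, or
    has a single occupied site [u]. The gap left of [u] and the gap right of it both range over the
    sizes [0, ..., m - 1] as [u] varies; this is the factor 2, and eventually the 2 in [2 log b]. *)
Lemma mean_deep_cell (B : nat -> nat -> nat -> R) :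
  (forall k m, B 0%N k.+1 m <= 0) ->
  (forall t m, B t 0%N m <= a ^+ t *+ m) ->
  (forall t k m, (m <= b)%N ->
    B t.+1 k.+1 m <= a ^+ m * (B t k.+1 m + q * (\sum_(u < m) B t k u *+ 2))) ->
  forall t k lo hi L, (lo <= hi <= b)%N -> size L = (t * b)%N -> admissible L ->
  B t k (hi - lo)%N <=
  \sum_(lo <= j < hi) bernoulli_mean L (fun x => (deep_cell b t k lo hi j x)%:R).
Proof.
move=> B0 Bk BS t k lo hi L lohi sL adm.
elim: t k lo hi L lohi sL adm => [|t IH] k lo hi L lohi sL adm.
  case: k => [|k].
    apply: le_trans (Bk _ _) _; rewrite -sumr_const_nat big_nat [leRHS]big_nat.
    by apply: ler_sum => j jI; apply: mean_stay_vacant; rewrite ?sL//; lia.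
  by apply: le_trans (B0 _ _) _; apply: sumr_ge0 => j _;
    apply: bernoulli_mean_ge0 (admissible01 adm) _ => x; rewrite ler0n.
case: k => [|k].
  apply: le_trans (Bk _ _) _; rewrite -sumr_const_nat big_nat [leRHS]big_nat.
  by apply: ler_sum => j jI; apply: mean_stay_vacant; rewrite ?sL//; lia.
have bL : (b <= size L)%N by rewrite sL mulSn leq_addr.
move: adm; rewrite -(cat_take_drop b L) /admissible all_cat => /andP[].
move: (size_takel bL) (size_drop b L); rewrite sL mulSn addKn.
set L1 := take b L; set L2 := drop b L => sL1 sL2 adm1 adm2.
have L101 := admissible01 adm1; have L201 := admissible01 adm2.
pose G k' lo' hi' j :=
  bernoulli_mean L2 (fun y => (deep_cell b t k' lo' hi' j y)%:R).
have G0 k' lo' hi' j : 0 <= G k' lo' hi' j.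
  by apply: bernoulli_mean_ge0 => // y; rewrite ler0n.
pose C j u := (j < u)%N%:R * G k lo u j + (u < j)%N%:R * G k u.+1 hi j.
apply: (@le_trans _ _ (\sum_(lo <= j < hi) (a ^+ (hi - lo) *
    (G k.+1 lo hi j + q * \sum_(lo <= u < hi) C j u)))); last first.
  apply: ler_sum => j _; rewrite bernoulli_mean_cat.
  apply: (@le_trans _ _ (bernoulli_mean L1 (fun x => G k.+1 lo hi j *
      (vacant lo hi x)%:R +
      \sum_(lo <= u < hi) C j u * (only_occupied lo hi u x)%:R))).
    rewrite bernoulli_meanD bernoulli_meanZ bernoulli_mean_sum mulrDr.
    apply: lerD.
      by rewrite mulrC ler_wpM2l ?G0// mean_vacant// sL1; lia.
    rewrite mulrA mulr_sumr big_nat [leRHS]big_nat; apply: ler_sum => u uI.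
    rewrite bernoulli_meanZ mulrC ler_wpM2l//; last first.
      by rewrite mulrC mean_only_occupied// sL1; lia.
    by rewrite addr_ge0// mulr_ge0.
  apply: bernoulli_mean_le => // x sx.
  apply: (@le_trans _ _ (bernoulli_mean L2 (fun y =>
      (vacant lo hi x)%:R * (deep_cell b t k.+1 lo hi j y)%:R +
      \sum_(lo <= u < hi) (only_occupied lo hi u x)%:R *
        ((j < u)%N%:R * (deep_cell b t k lo u j y)%:R +
         (u < j)%N%:R * (deep_cell b t k u.+1 hi j y)%:R)))).
    rewrite bernoulli_meanD bernoulli_meanZ bernoulli_mean_sum mulrC lerD2l.
    apply: ler_sum => u _; rewrite bernoulli_meanZ bernoulli_meanD.
    by rewrite !bernoulli_meanZ mulrC.
  apply: bernoulli_mean_le => // y sy.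
  have nthx i : (i < b)%N -> nth false (x ++ y) i = nth false x i.
    by rewrite nth_cat sx sL1 => ->.
  have -> : vacant lo hi x = vacant lo hi (x ++ y).
    by apply: eq_in_all => i; rewrite mem_iota => iI; rewrite nthx//; lia.
  under eq_bigr => u _.
    rewrite (_ : only_occupied lo hi u x = only_occupied lo hi u (x ++ y)).
      over.
    by apply: eq_in_all => i; rewrite mem_iota => iI; rewrite nthx//; lia.
  have := deep_cell_ge t k lo hi j (x ++ y).
  by rewrite drop_size_cat// sx.
apply: le_trans (BS t k (hi - lo)%N _) _; first lia.
have -> : \sum_(lo <= j < hi) (a ^+ (hi - lo) *
      (G k.+1 lo hi j + q * \sum_(lo <= u < hi) C j u)) =
    a ^+ (hi - lo) * (\sum_(lo <= j < hi) G k.+1 lo hi j +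
      q * \sum_(lo <= j < hi) \sum_(lo <= u < hi) C j u).
  by rewrite mulr_sumr -big_split mulr_sumr.
rewrite ler_wpM2l ?exprn_ge0//; apply: lerD; first exact: IH.
apply: ler_wpM2l => //.
rewrite exchange_big_nat /=.
have sub_lo : \sum_(lo <= u < hi) B t k (u - lo)%N = \sum_(u < hi - lo) B t k u.
  rewrite -{1}[lo]add0n big_addn big_mkord.
  by apply: eq_bigr => u _; rewrite addnK.
have hi_sub : \sum_(lo <= u < hi) B t k (hi - u.+1)%N =
    \sum_(u < hi - lo) B t k u.
  rewrite -{1}[lo]add0n big_addn big_mkord (reindex_inj rev_ord_inj) /=.
  by apply: eq_bigr => u _; congr (B t k _); have := ltn_ord u; lia.
rewrite sumrMnl mulr2n -{1}sub_lo -hi_sub -big_split /=.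
rewrite big_nat [leRHS]big_nat; apply: ler_sum => u uI.
rewrite big_split /=; apply: lerD.
  apply: (@le_trans _ _ (\sum_(lo <= j < u) G k lo u j)).
    by apply: IH => //; lia.
  rewrite [leRHS](@big_cat_nat _ _ _ u)//=; try lia.
  rewrite -[leLHS]addr0; apply: lerD.
    rewrite big_nat [leRHS]big_nat le_eqVlt; apply/orP; left; apply/eqP.
    by apply: eq_bigr => j /andP[_ ->]; rewrite mul1r.
  by apply: sumr_ge0 => j _; rewrite mulr_ge0.
apply: (@le_trans _ _ (\sum_(u.+1 <= j < hi) G k u.+1 hi j)).
  by apply: IH => //; lia.
rewrite [leRHS](@big_cat_nat _ _ _ u.+1)//=; try lia.
rewrite -[leLHS]add0r; apply: lerD.
  by apply: sumr_ge0 => j _; rewrite mulr_ge0.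
rewrite big_nat [leRHS]big_nat le_eqVlt; apply/orP; left; apply/eqP.
by apply: eq_bigr => j /andP[-> _]; rewrite mul1r.
Qed.

End first_moment.

Fixpoint sites (b T g : nat) : nat :=
  if g is g'.+1 then (T * b + b * sites b T g')%N else 0%N.

(* Every deep cell of a block is the root of its own next generation, which
   reads its own disjoint set of sites. *)
Fixpoint survives (b T l g : nat) (x : seq bool) : bool :=
  if g is g'.+1 then
    has (fun j => deep_cell b T l 0 b j (take (T * b) x) &&
           survives b T l g' (nth [::] (reshape (nseq b (sites b T g'))
                                                (drop (T * b) x)) j)) (iota 0 b)
  else true.

(** * Survival of the branching process *)

Section survival.
Context {R : realFieldType}.
Variables (a q : R) (b T l : nat).
Hypotheses (a0 : 0 <= a) (b0 : (0 < b)%N).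

(** With [y = p Z], [(1 - p)^Z (1 + y) <= (1 - p^2)^Z <= 1], and [1 / (1 + y) <= 1 - y / 2] for [y]
    in [0, 1]. *)
Lemma one_sub_exp_ge (p : R) (Z : nat) : 0 <= p -> p *+ Z <= 1 ->
  p / 2 *+ Z <= 1 - (1 - p) ^+ Z.
Proof.
move=> p0 pZ.
have pZ' n : (n <= Z)%N -> p *+ n <= 1.
  by move=> nZ; apply: le_trans pZ; rewrite ler_wpMn2l.
have [->|Z0] := posnP Z; first by rewrite mulr0n expr0 subrr.
have p1 : p <= 1 by have := pZ' 1%N Z0; rewrite mulr1n.
suff : (1 - p) ^+ Z * (1 + p *+ Z) <= 1.
  set e := _ ^+ _; rewrite -mulrnAl; have e0 : 0 <= e.
    by rewrite exprn_ge0// subr_ge0.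
  move: (p *+ Z) pZ (mulrn_wge0 Z p0) => y y1 y0 ey.
  have e1 : e <= 1 by have := mulr_ge0 e0 y0; lra.
  have : 0 <= (1 - e) * (1 - y) by rewrite mulr_ge0// subr_ge0.
  by lra.
apply: (@le_trans _ _ ((1 - p) ^+ Z * (1 + p) ^+ Z)).
  rewrite ler_wpM2l//; first by rewrite exprn_ge0// subr_ge0.
  elim: Z {Z0 pZ pZ'} => [|Z IH]; first by rewrite mulr0n addr0 expr0.
  rewrite exprS mulrS; have := mulrn_wge0 Z p0; move: (p *+ Z) IH => ? ? ?.
  by nra.
by rewrite -exprMn exprn_ile1//; nra.
Qed.

Lemma mean_survives (g : nat) (L : seq R) :
  (forall L1, size L1 = (T * b)%N -> admissible a q L1 ->
     2 <= \sum_(0 <= j < b)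
       bernoulli_mean L1 (fun x => (deep_cell b T l 0 b j x)%:R)) ->
  size L = sites b T g -> admissible a q L ->
  b%:R^-1 <= bernoulli_mean L (fun x => (survives b T l g x)%:R).
Proof.
move=> two; elim: g L => [|g IH] L sL adm.
  by rewrite /= bernoulli_mean_cst invf_le1 ?ler1n// ltr0n.
have TbL : (T * b <= size L)%N by rewrite sL leq_addr.
move: adm; rewrite -(cat_take_drop (T * b) L) /admissible all_cat => /andP[].
move: (size_takel TbL) (size_drop (T * b) L); rewrite sL addKn.
set L1 := take _ L; set L2 := drop _ L => sL1 sL2 adm1 adm2.
have L101 := admissible01 a0 adm1; have L201 := admissible01 a0 adm2.
pose sh := nseq b (sites b T g).
have sumsh : sumn sh = size L2 by rewrite sumn_nseq sL2 mulnC.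
pose Ls := reshape sh L2.
have shLs : shape Ls = sh by rewrite reshapeKl// sumsh.
have L2E : flatten Ls = L2 by rewrite reshapeKr// sumsh.
have sLs : size Ls = b by rewrite -(size_map size) -/(shape _) shLs size_nseq.
have admLs j : (j < b)%N -> admissible a q (nth [::] Ls j).
  move=> jb; apply/allP => p pj; apply: (allP adm2); rewrite -L2E.
  by apply/flattenP; exists (nth [::] Ls j); rewrite ?mem_nth ?sLs.
have szLs j : (j < b)%N -> size (nth [::] Ls j) = sites b T g.
  move=> jb; have := congr1 (fun s => nth 0%N s j) shLs.
  by rewrite (nth_map [::]) ?sLs// nth_nseq jb.
rewrite bernoulli_mean_cat.
apply: (@le_trans _ _ (bernoulli_mean L1 (fun x => (2 * b%:R)^-1 *
   \sum_(0 <= j < b) (deep_cell b T l 0 b j x)%:R))).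
  rewrite bernoulli_meanZ bernoulli_mean_sum invfM mulrC mulrA.
  rewrite ler_peMl ?invr_ge0//.
  by rewrite ler_pdivlMr ?mul1r//; exact: two.
apply: bernoulli_mean_le => // x sx.
pose s j := bernoulli_mean (nth [::] Ls j) (fun y => (survives b T l g y)%:R).
have s1 j : (j < b)%N -> s j <= 1.
  move=> jb; rewrite -(bernoulli_mean_cst (nth [::] Ls j) 1).
  apply: bernoulli_mean_le (admissible01 a0 (admLs _ jb)) _ => y _.
  by case: survives; rewrite ?ler01.
(* Given the first block, extinction means that every deep cell fails in its own sites; these events
   are independent. *)
have -> : bernoulli_mean L2 (fun y => (survives b T l g.+1 (x ++ y))%:R) =
    1 - \prod_(j < b) (1 - (deep_cell b T l 0 b j x)%:R * s j).
  transitivity (1 - bernoulli_mean (flatten Ls) (fun y => \prod_(j < size Ls)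
     (1 - (deep_cell b T l 0 b j x)%:R *
        (survives b T l g (nth [::] (reshape (shape Ls) y) j))%:R))); last first.
    rewrite (bernoulli_mean_flatten Ls (fun j y =>
      1 - (deep_cell b T l 0 b j x)%:R * (survives b T l g y)%:R)) sLs.
    congr (1 - _); apply: eq_bigr => j _; rewrite /s -[in RHS]mulNr.
    rewrite -[X in _ = X + _](bernoulli_mean_cst (nth [::] Ls j)).
    rewrite -bernoulli_meanZ -bernoulli_meanD.
    by apply: bernoulli_mean_eq => y _; rewrite mulNr.
  rewrite L2E -[X in _ = X - _](bernoulli_mean_cst L2) -mulN1r -bernoulli_meanZ.
  rewrite -bernoulli_meanD; apply: bernoulli_mean_eq => y sy.
  rewrite shLs sLs /= take_size_cat ?sx// drop_size_cat ?sx//.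
  have [/hasP[j]|/hasPn none] := boolP (has _ _).
    rewrite mem_iota => /andP[_ jb] /andP[d v].
    by rewrite (bigD1 (Ordinal jb))//= d v mulr1 subrr mul0r mulr0 addr0.
  rewrite big1 ?mulr1 ?subrr// => j _; rewrite -natrM mulnb.
  have /none/negbTE-> : (j : nat) \in iota 0 b by rewrite mem_iota /=.
  by rewrite subr0.
pose Z := (\sum_(0 <= j < b) deep_cell b T l 0 b j x)%N.
have -> : \sum_(0 <= j < b) (deep_cell b T l 0 b j x)%:R = Z%:R :> R.
  by rewrite natr_sum.
have Zb : (Z <= b)%N.
  rewrite -[leqRHS]subn0 -[leqRHS]mul1n mulnC -sum_nat_const_nat.
  by apply: leq_sum => j _; case: deep_cell.
have bZ : b%:R^-1 *+ Z <= 1 :> R.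
  by rewrite -[_ *+ Z]mulr_natl ler_pdivrMr ?mul1r ?ler_nat ?ltr0n.
have b'0 : 0 <= b%:R^-1 :> R by rewrite invr_ge0.
apply: (@le_trans _ _ (1 - (1 - b%:R^-1) ^+ Z)).
  by rewrite invfM mulr_natr [X in X *+ Z]mulrC; exact: one_sub_exp_ge.
rewrite lerD2l lerN2 /Z -(big_mkord xpredT (fun j =>
  1 - (deep_cell b T l 0 b j x)%:R * s j)) -prodrXr.
rewrite big_nat [leRHS]big_nat; apply: ler_prod => j /= jb.
have sj : b%:R^-1 <= s j by apply: IH; [exact: szLs | exact: admLs].
have := s1 _ jb.
by case: deep_cell; rewrite ?expr1 ?expr0 ?mul1r ?mul0r ?subr0; lra.
Qed.

End survival.

(** * Mean number of deep cells *)

(** A discrete [log (m / d)], zero for the gaps of at most [d] cells. *)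
Definition harmonic_from {R : realFieldType} (d m : nat) : R :=
  \sum_(d <= u < m) u%:R^-1.

(* A lower bound for the mean number of cells at depth [k] in the random
   splitting of a gap of [m] cells: without the shifts it is
   [(2 log m)^k / k! / m], the [k]-th term of a Poisson law of mean [2 log m]
   multiplied by [m]. *)
Definition cell_profile {R : realFieldType} (d k m : nat) : R :=
  m%:R^-1 * (2 ^+ k * Num.max 0 (harmonic_from d m - k%:R / d%:R) ^+ k
             / k`!%:R).

Section cell_profile.
Context {R : realType}.
Implicit Types (d k m : nat).

Lemma cell_profile_ge0 d k m : 0 <= cell_profile d k m :> R.
Proof.
by rewrite /cell_profile !mulr_ge0 ?invr_ge0 ?exprn_ge0// le_max lexx.
Qed.

Lemma cell_profile0 d m : cell_profile d 0 m <= m%:R :> R.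
Proof.
rewrite /cell_profile !expr0 !mul1r fact0 invr1 mulr1.
case: m => [|m]; first by rewrite invr0.
by rewrite (@le_trans _ _ 1)// ?invf_le1// ler1n.
Qed.

Lemma harmonic_from_small d m : (m <= d)%N -> harmonic_from d m = 0 :> R.
Proof. by move=> mu; rewrite /harmonic_from big_geq. Qed.

Lemma cell_profile_small d k m : (0 < d)%N -> (m <= d)%N ->
  cell_profile d k.+1 m = 0 :> R.
Proof.
move=> d_gt0 mu; rewrite /cell_profile harmonic_from_small// sub0r.
by rewrite max_l ?oppr_le0 ?divr_ge0// expr0n mulr0 mul0r mulr0.
Qed.

Lemma subrXX_le (x y : R) n : 0 <= y <= x ->
  x ^+ n.+1 - y ^+ n.+1 <= n.+1%:R * (x - y) * x ^+ n.
Proof.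
move=> /andP[y0 yx]; rewrite subrXX [n.+1%:R * _]mulrC -mulrA.
rewrite ler_wpM2l ?subr_ge0// mulr_natl -[X in _ *+ X]card_ord -sumr_const.
apply: ler_sum => i _.
have -> : x ^+ n = x ^+ (n.+1.-1 - i) * x ^+ i.
  by rewrite -exprD subnK// -ltnS.
by rewrite ler_wpM2l ?exprn_ge0 ?(le_trans y0)// lerXn2r// nnegrE (le_trans y0).
Qed.

(** The discrete form of the identity that [(log m)^(k+1)] is the integral of [(k+1) (log u)^k / u]
    from 1 to [m]. The increment of the power is bounded by the derivative at the right end of a
    step, whereas the sum has the left end; lowering the logarithm by [1/d] at each level makes up
    for a step [1/m <= 1/d]. *)
Lemma cell_profileS d k m : (0 < d)%N ->
  m%:R * cell_profile d k.+1 m <= \sum_(u < m) cell_profile d k u *+ 2 :> R.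
Proof.
move=> d_gt0; have dR : 0 < d%:R :> R by rewrite ltr0n.
pose A := @harmonic_from R d; pose z k m : R := Num.max 0 (A m - k%:R / d%:R).
have z0 k' m' : 0 <= z k' m' by rewrite /z le_max lexx.
suff key : z k.+1 m ^+ k.+1 <= k.+1%:R * \sum_(u < m) u%:R^-1 * z k u ^+ k.
  have -> : \sum_(u < m) cell_profile d k u *+ 2 =
      2 ^+ k.+1 / k`!%:R * \sum_(u < m) u%:R^-1 * z k u ^+ k :> R.
    rewrite mulr_sumr; apply: eq_bigr => u _.
    by rewrite /cell_profile -/(A u) -/(z k u) -mulr_natr exprS; ring.
  case: m key => [|m] key; first by rewrite mul0r big_ord0 mulr0.
  rewrite /cell_profile -/(A _) -/(z _ _) mulVKf ?pnatr_eq0//.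
  rewrite -[leLHS]mulrA -[leRHS]mulrA ler_wpM2l ?exprn_ge0//.
  rewrite factS natrM invfM [X in _ * X]mulrC mulrCA.
  rewrite ler_pM2l ?invr_gt0 ?ltr0n ?fact_gt0//.
  by rewrite ler_pdivrMr ?ltr0n// mulrC.
elim: m => [|m IH].
  rewrite big_ord0 mulr0 /z /A harmonic_from_small// sub0r.
  by rewrite max_l ?oppr_le0 ?divr_ge0// expr0n lexx.
have [dm|md] := leqP d m; last first.
  rewrite /z /A harmonic_from_small// sub0r max_l ?oppr_le0 ?divr_ge0//.
  rewrite expr0n mulr_ge0// sumr_ge0// => i _.
  by rewrite mulr_ge0 ?invr_ge0 ?exprn_ge0//; exact: z0.
rewrite big_ord_recr /= mulrDr; set S := \sum_(i < m) _ in IH *.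
have m0 : 0 < m%:R :> R by rewrite ltr0n (leq_trans d_gt0).
have dm' : m%:R^-1 <= d%:R^-1 :> R by rewrite lef_pV2 ?posrE// ler_nat.
have AS : A m.+1 = A m + m%:R^-1 by rewrite /A /harmonic_from big_nat_recr.
have kd : k.+1%:R / d%:R = k%:R / d%:R + d%:R^-1 :> R.
  by rewrite -natr1 mulrDl mul1r.
have iv0 : 0 < m%:R^-1 :> R by rewrite invr_gt0.
have zS : z k.+1 m.+1 <= z k.+1 m + m%:R^-1.
  rewrite /z AS kd /Num.max; case: ifP; case: ifP; lra.
have zm : z k.+1 m <= z k.+1 m.+1.
  by rewrite /z AS kd /Num.max; case: ifP; case: ifP; lra.
have zk : z k.+1 m.+1 <= z k m.
  by rewrite /z AS kd /Num.max; case: ifP; case: ifP; lra.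
have := @subrXX_le (z k.+1 m.+1) (z k.+1 m) k.
rewrite z0 zm lerBlDl => /(_ isT)/le_trans; apply; apply: lerD IH _.
rewrite -mulrA ler_wpM2l//; apply: ler_pM => //; rewrite ?subr_ge0 ?exprn_ge0//.
  by rewrite lerBlDl.
by rewrite lerXn2r// nnegrE.
Qed.

Lemma ln_div_le_harmonic_from d m : (0 < d)%N -> (0 < m)%N ->
  ln (m%:R / d%:R) <= harmonic_from d m :> R.
Proof.
move=> d0 m0; have [md|] := leqP m d.
  rewrite harmonic_from_small// ln_le0// ler_pdivrMr ?ltr0n// mul1r.
  by rewrite ler_nat.
elim: m m0 => // m IH _; rewrite ltnS leq_eqVlt => /orP[/eqP<-|dm].
  rewrite /harmonic_from big_nat1 -natr1 mulrDl mul1r divff ?pnatr_eq0 -?lt0n//.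
  by apply: le_ln1Dx; rewrite (lt_trans (ltrN10 _))// invr_gt0 ltr0n.
have m0 : (0 < m)%N by rewrite (leq_trans _ dm).
rewrite /harmonic_from big_nat_recr/= ?(ltnW dm)//.
have -> : m.+1%:R / d%:R = m%:R / d%:R * (1 + m%:R^-1) :> R.
  by rewrite mulrDr mulr1 mulrAC divff ?pnatr_eq0 -?lt0n// -natr1 mulrDl.
have mR : 0 < m%:R^-1 :> R by rewrite invr_gt0 ltr0n.
rewrite lnM ?posrE ?divr_gt0 ?ltr0n ?addr_gt0//; apply: lerD.
  exact: IH.
by apply: le_ln1Dx; lra.
Qed.

End cell_profile.

Section block_mean.
Context {R : realType}.

Lemma expR_le2 (x : R) : x <= 2^-1 -> expR x <= 2.
Proof.
move=> x2; rewrite -[x]opprK expRN -[leRHS]invrK lef_pV2 ?posrE ?expR_gt0 ?invr_gt0//.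
by apply: le_trans (expR_ge1Dx _); lra.
Qed.

(* Here [x] is the mean number of points of a gap in one row; the two terms on
   the right stand for a vacant row and for a row with one occupied site. *)
Lemma waiting_step (x y D r : R) : 0 <= x <= y -> y <= 2^-1 -> 0 <= D ->
  expR (- (x / 2)) <= r ->
  Num.max 0 (1 - 4 * D * r) <=
  expR (- x) * (Num.max 0 (1 - 4 * D) + x * expR y * Num.max 0 (1 - D)).
Proof.
move=> /andP[x0 xy] y2 D0 xr; rewrite ge_max; apply/andP; split.
  by rewrite !mulr_ge0 ?addr_ge0 ?mulr_ge0 ?expR_ge0 ?le_max ?lexx.
apply: (@le_trans _ _ (expR (- x) * ((1 - 4 * D) + x * expR y * (1 - D)))).
  set e := expR (- x).
  rewrite (_ : e * _ = e * (1 + x * expR y) - 4 * (D * (e * (1 + x * expR y / 4))));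
    last by lra.
  (* Vacancy and a single occupied site together get weight at least 1; the factor [expR y] makes up
     for the discarded rows with several occupied sites. *)
  have e1 : 1 <= e * (1 + x * expR y).
    rewrite mulrDr mulr1 mulrCA -expRD.
    have := @expR_ge1Dx R (- x); have := @expR_ge1Dx R (- x + y) => h1 h2.
    by apply: le_trans (lerD h2 (ler_wpM2l x0 h1)); nra.
  (* The factor 4 per splitting comes from here: as [expR y <= 2], [1 + x * expR y / 4 <= 1 + x / 2
     <= expR (x / 2)], so the error term decays in every row. *)
  have e2 : e * (1 + x * expR y / 4) <= r.
    apply: le_trans xr; have -> : expR (- (x / 2)) = e * expR (x / 2).
      by rewrite -expRD; congr expR; lra.
    rewrite ler_wpM2l ?expR_ge0//.
    apply: le_trans (expR_ge1Dx _); rewrite lerD2l.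
    by have := expR_le2 y2; nra.
  have := ler_wpM2l D0 e2; lra.
by rewrite ler_wpM2l ?expR_ge0// lerD ?ler_wpM2l ?mulr_ge0 ?expR_ge0// le_max
  lexx orbT.
Qed.

(** The factors account in turn for the cell staying vacant during [T] rows, for the loss at each of
    the [l] splittings (intensity, then multiple occupation), for the rows running out too early,
    and for the splitting itself. *)
Lemma mean_deep_cell_ge (kap lam : R) (l b T d : nat) (L : seq R) :
  0 <= kap -> 0 <= lam -> lam * b%:R <= 2^-1 -> (0 < d)%N ->
  size L = (T * b)%N -> admissible (expR (- lam)) (kap * lam) L ->
  expR (- lam) ^+ T * (kap * expR (- (lam * b%:R))) ^+ l *
    (1 - 4 ^+ l * expR (- (lam * d%:R / 2)) ^+ T) * cell_profile d l b <=
  \sum_(0 <= j < b)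
    bernoulli_mean L (fun x => (deep_cell b T l 0 b j x)%:R).
Proof.
move=> kap0 lam0 lamb d0 sL adm.
set a := expR (- lam); set al := expR (- (lam * b%:R)).
set r := expR (- (lam * d%:R / 2)).
have a0 : 0 <= a by exact: expR_ge0.
have a1 : a <= 1 by rewrite expR_le1 oppr_le0.
have r1 : 0 <= r <= 1.
  by rewrite expR_ge0 expR_le1 oppr_le0 !mulr_ge0// invr_ge0.
have al0 : 0 <= al by exact: expR_ge0.
pose f := @cell_profile R d.
have f0 k m : 0 <= f k m by exact: cell_profile_ge0.
(* [w] accounts for the rows running out before the [k]-th splitting.  Gaps of
   at most [d] cells are given up, so that the bound [a ^+ m] on the probability
   that a row of the current gap is vacant is at most [r ^+ 2]. *)
pose w t k : R := Num.max 0 (1 - 4 ^+ k * r ^+ t).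
have w0 t k : 0 <= w t k by rewrite le_max lexx.
pose B t k m := a ^+ t * (kap * al) ^+ k * w t k * f k m.
have B0 t k m : 0 <= B t k m.
  by rewrite /B mulr_ge0// mulr_ge0// mulr_ge0 ?exprn_ge0 ?mulr_ge0.
apply: (@le_trans _ _ (B T l b)).
  rewrite ler_wpM2r// ler_wpM2l ?mulr_ge0 ?exprn_ge0 ?mulr_ge0//.
  by rewrite le_max lexx orbT.
rewrite -[in B _ _ _](subn0 b).
have bb : (0 <= b <= b)%N by rewrite leqnn.
apply: (@mean_deep_cell _ a (kap * lam) b a0 a1 _ B _ _ _ T l 0 b L) => //.
- exact: mulr_ge0.
- move=> k m; rewrite /B /w expr0 mulr1 max_l ?mulr0 ?mul0r//.
  by rewrite subr_le0 exprn_ege1// ler1n.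
- move=> t m; rewrite /B expr0 mulr1 -mulr_natr -mulrA ler_wpM2l ?exprn_ge0//.
  rewrite -[leRHS]mul1r; apply: ler_pM => //; last exact: cell_profile0.
  rewrite /w expr0 mul1r ge_max ler01 /= gerBl exprn_ge0//.
  by case/andP: r1.
move=> t k m mb.
have S0 : 0 <= \sum_(u < m) B t k u *+ 2.
  by apply: sumr_ge0 => u _; rewrite mulrn_wge0.
have [md|dm] := leqP m d.
  rewrite {1}/B /f cell_profile_small// mulr0 mulr_ge0 ?exprn_ge0//.
  apply: addr_ge0; last by rewrite mulr_ge0// mulr_ge0.
  exact: B0.
have -> : \sum_(u < m) B t k u *+ 2 =
    a ^+ t * (kap * al) ^+ k * w t k * \sum_(u < m) f k u *+ 2.
  by rewrite mulr_sumr; apply: eq_bigr => u _; rewrite mulrnAr.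
set s := \sum_(u < m) _.
have fs : m%:R * f k.+1 m <= s by exact: cell_profileS.
have am : a ^+ m = expR (- (lam * m%:R)).
  by rewrite -expRM_natr mulNr.
pose x := lam * m%:R.
have step : w t.+1 k.+1 <=
    a ^+ m * (w t k.+1 + x * expR (lam * b%:R) * w t k).
  rewrite am /w.
  rewrite (_ : 4 ^+ k.+1 * r ^+ t.+1 = 4 * (4 ^+ k * r ^+ t) * r); last first.
    by rewrite exprS exprSr; ring.
  rewrite exprS -[4 * _ * r ^+ t]mulrA; apply: waiting_step => //.
  - by rewrite mulr_ge0//= ler_wpM2l// ler_nat.
  - by rewrite mulr_ge0// exprn_ge0//; case/andP: r1.
  - by rewrite ler_expR lerN2 ler_pM2r// ler_wpM2l// ler_nat ltnW.
have al1 : al * expR (lam * b%:R) = 1 by rewrite mulrC expRxMexpNx_1.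
apply: (@le_trans _ _ (a ^+ t * (kap * al) ^+ k.+1 *
    (a ^+ m * (w t k.+1 + x * expR (lam * b%:R) * w t k)) * f k.+1 m)).
  rewrite /B ler_wpM2r//; apply: ler_pM; rewrite ?mulr_ge0 ?exprn_ge0 ?mulr_ge0//.
  by rewrite ler_wpM2r ?exprn_ge0 ?mulr_ge0// exprSr ler_piMr ?exprn_ge0.
have -> : a ^+ t * (kap * al) ^+ k.+1 *
    (a ^+ m * (w t k.+1 + x * expR (lam * b%:R) * w t k)) * f k.+1 m =
  a ^+ m * (B t k.+1 m + kap * lam * (a ^+ t * (kap * al) ^+ k * w t k *
    (m%:R * f k.+1 m)) * (al * expR (lam * b%:R))).
  by rewrite /B /x exprS; ring.
rewrite al1 mulr1 ler_wpM2l ?exprn_ge0// lerD2l ler_wpM2l ?mulr_ge0//.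
by rewrite ler_wpM2l// !mulr_ge0 ?exprn_ge0 ?mulr_ge0.
Qed.

(** The upper half of Stirling's formula with a polynomial loss, [l! <= e l (l/e)^l]. The induction
    step amounts to [1 - 1/(l+2) <= exp (- 1/(l+2))] raised to the power [l+2]. *)
Lemma fact_le_expR (l : nat) : (0 < l)%N ->
  l`!%:R * expR l%:R <= expR 1 * l%:R * l%:R ^+ l :> R.
Proof.
case: l => // l _; elim: l => [|l IH].
  by rewrite (_ : 1`! = 1)%N// mul1r expr1 !mulr1.
rewrite factS natrM -[in expR _]natr1 expRD.
apply: (@le_trans _ _ (l.+2%:R * expR 1 * (expR 1 * l.+1%:R * l.+1%:R ^+ l.+1))).
  rewrite (_ : l.+2%:R * _ * _ = l.+2%:R * expR 1 * (l.+1`!%:R * expR l.+1%:R));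
    last by ring.
  by rewrite ler_wpM2l ?mulr_ge0 ?expR_ge0.
suff h : expR 1 * l.+1%:R ^+ l.+2 <= l.+2%:R ^+ l.+2 :> R.
  rewrite (_ : _ * _ = expR 1 * l.+2%:R * (expR 1 * l.+1%:R ^+ l.+2)); last first.
    by rewrite [in RHS]exprS; ring.
  by rewrite ler_wpM2l ?mulr_ge0 ?expR_ge0.
have -> : expR 1 = expR (l.+2%:R^-1) ^+ l.+2 :> R.
  by rewrite -expRM_natr mulVf// pnatr_eq0.
rewrite -exprMn lerXn2r// ?nnegrE ?mulr_ge0 ?expR_ge0//.
have : l.+1%:R / l.+2%:R <= expR (- l.+2%:R^-1) :> R.
  apply: le_trans (expR_ge1Dx _).
  rewrite -[in leLHS](addrK 1 l.+1%:R) natr1 mulrBl mul1r divff// pnatr_eq0//.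
rewrite expRN ler_pdivrMr ?ltr0n// -ler_pdivlMl ?expR_gt0//.
Qed.

End block_mean.

(** * Choice of the parameters *)

Section parameters.
Context {R : realType}.

Lemma linear_le_expR (K eta : R) : 0 < eta ->
  exists N : nat, forall l, (N <= l)%N -> K * l%:R <= expR (eta * l%:R).
Proof.
move=> eta0; pose x : R := `|2 * K / eta ^+ 2|.
exists (Num.bound x) => l Nl.
have xl : x <= l%:R.
  apply: ltW; apply: lt_le_trans (archi_boundP (normr_ge0 _)) _.
  by rewrite ler_nat.
have l0 : 0 <= eta * l%:R by rewrite mulr_ge0// ltW.
apply: (@le_trans _ _ ((eta * l%:R) ^+ 2 / 2)); last first.
  have := expR_ge1Dxn 1 l0; rewrite (_ : 2`! = 2)%N//.
  by apply: le_trans; rewrite lerDr.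
have -> : K * l%:R = (2 * K / eta ^+ 2) * l%:R * (eta ^+ 2 / 2).
  by field; rewrite gt_eqF.
have -> : (eta * l%:R) ^+ 2 / 2 = l%:R * l%:R * (eta ^+ 2 / 2) by ring.
rewrite ler_wpM2r ?divr_ge0 ?sqr_ge0// ler_wpM2r//.
by apply: le_trans xl; rewrite ler_norm.
Qed.

(* [1 + ln 2 + ln s - s] is the exponential rate of the mean number of gaps of
   size [exp (- s l)] at depth [l]; it vanishes at [s = 1 / c]. *)
Lemma growth_rate_gt0 (c eps s : R) :
  2 <= c -> c * ln (2 * expR 1 / c) = 1 -> 0 < eps < 1 ->
  s = (c * (1 - eps / 2))^-1 -> 0 < 1 + ln 2 + ln s - s.
Proof.
move=> c2 ce /andP[e0 e1] sE.
have c0 : 0 < c by apply: lt_le_trans c2.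
have e2 : 0 < 1 - eps / 2 by lra.
have lnc : 1 + ln 2 = c^-1 + ln c.
  have : ln (2 * expR 1 / c) = c^-1.
    by apply: (mulfI (lt0r_neq0 c0)); rewrite ce divff// gt_eqF.
  rewrite ln_div ?lnM ?posrE ?mulr_gt0 ?expR_gt0// expRK; lra.
have lns : ln s = - ln c - ln (1 - eps / 2).
  by rewrite sE lnV ?posrE ?mulr_gt0// lnM ?posrE// opprD.
rewrite lnc lns.
have h : ln (1 - eps / 2) <= - (eps / 2) by apply: le_ln1Dx; lra.
(* The equation of [c] leaves a rate of at least [eps / 2 - (s - 1/c)], and [c >= 2] bounds the
   difference [eps / (2 - eps) / c]. *)
suff : s - c^-1 < eps / 2 by lra.
have -> : s - c^-1 = c^-1 * (eps / (2 - eps)).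
  by rewrite sE; field; rewrite !gt_eqF//; lra.
apply: (@le_lt_trans _ _ (2^-1 * (eps / (2 - eps)))).
  by apply: ler_wpM2r; [apply: divr_ge0; lra | rewrite lef_pV2 ?posrE].
rewrite mulrC ltr_pM2r ?invr_gt0// ltr_pdivrMr; last lra.
by nra.
Qed.

(** The ratio [l / ln b] is aimed at [(1 - eps / 2) c]: being below [c] it gives exponential growth,
    being above [(1 - eps) c] it leaves room for rounding [b]. *)
Lemma branching_parameters (c eps : R) :
  2 <= c -> c * ln (2 * expR 1 / c) = 1 -> 0 < eps < 1 ->
  exists (kap : R) (l b T : nat),
    [/\ 0 < kap < 1, (1 < b)%N, (0 < T)%N, (1 - eps) * c * ln b%:R < l%:R &
      forall L, size L = (T * b)%N ->
        admissible (expR (- T%:R^-1)) (kap / T%:R) L ->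
        2 <= \sum_(0 <= j < b)
          bernoulli_mean L (fun x => (deep_cell b T l 0 b j x)%:R)].
Proof.
move=> c2 ce eps01; have [e0 e1] := andP eps01.
have c0 : 0 < c by apply: lt_le_trans c2.
pose s := (c * (1 - eps / 2))^-1.
have := growth_rate_gt0 c2 ce eps01 (erefl s).
set gam := _ - s => gam0.
have e2 : 0 < 1 - eps / 2 by lra.
have s0 : 0 < s by rewrite invr_gt0 mulr_gt0.
(* [kap ^ l] is lost twice, once for the intensity and once when [harmonic_from d b] is bounded
   below by a multiple of [kap * s * l]; half of the rate [gam] remains. *)
pose kap := expR (- (gam / 4)).
have kap0 : 0 < kap by exact: expR_gt0.
have kap1 : kap < 1 by rewrite expR_lt1; lra.
have eta0 : 0 < (1 - kap) * s by rewrite mulr_gt0// subr_gt0.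
(* Makes [ln d + 1/4 <= (1 - kap) s l] for [d = 4 l + 4], as [(4 l + 4) expR (1/4) <= 16 l]. *)
have [N1 HN1] := linear_le_expR 16 eta0.
have gam2 : 0 < gam / 2 by lra.
(* The final bound is [expR (gam l / 2) / (4 l expR (5/2))], which has to be at least 2. *)
have [N2 HN2] := linear_le_expR (8 * expR (5 / 2)) gam2.
(* Beyond [x], [l] exceeds [(1 - eps) c (ln 2 + s l)]; the [ln 2] comes from [b <= 2 expR (s l)]. *)
pose x : R := (1 - eps) * c * ln 2 / (1 - (1 - eps) * c * s).
pose N3 := Num.bound `|x|.
have [l [lN1 lN2 lN3 l_gt0]] : exists l, [/\ (N1 <= l)%N, (N2 <= l)%N,
    (N3 <= l)%N & (0 < l)%N].
  by exists (maxn (maxn N1 N2) (maxn N3 1)); rewrite !leq_max !leqnn !orbT.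
have l0 : 0 < l%:R :> R by rewrite ltr0n.
have l1 : 1 <= l%:R :> R by rewrite ler1n.
move: HN1 HN2 => /(_ _ lN1) HN1 /(_ _ lN2) HN2.
have HN3 : x < l%:R.
  apply: le_lt_trans (ler_norm _) _.
  apply: lt_le_trans (archi_boundP (normr_ge0 _)) _.
  by rewrite ler_nat.
pose b := (Num.truncn (expR (s * l%:R))).+1.
have bE : expR (s * l%:R) < b%:R by exact: truncnS_gt.
have E1 : 1 < expR (s * l%:R) by rewrite expR_gt1 mulr_gt0.
have b2E : b%:R <= 2 * expR (s * l%:R).
  have : (Num.truncn (expR (s * l%:R)))%:R <= expR (s * l%:R).
    by rewrite truncn_le// expR_ge0.
  by rewrite /b -natr1; lra.
have b1 : (1 < b)%N by rewrite -(ltr_nat R); apply: lt_trans bE.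
have bR0 : 0 < b%:R :> R by rewrite ltr0n ltnW.
(* With [lam = 1/T], this [T] gives [lam b = 1/(2 l)], so that [l] splittings lose only
   [expR (- 1/2)]. This [d] gives [4^l expR (- d/2) <= expR (- 2) <= 1/4] and [l / d <= 1/4]. *)
pose T := (2 * b * l)%N; pose d := (4 * l + 4)%N.
have T0 : 0 < T%:R :> R by rewrite ltr0n /T !muln_gt0 /= l_gt0.
exists kap, l, b, T; split => //.
- by rewrite kap0.
- by rewrite -(ltr_nat R).
- apply: (@le_lt_trans _ _ ((1 - eps) * c * (ln 2 + s * l%:R))).
    rewrite ler_wpM2l//; first by apply: mulr_ge0; lra.
    have -> : ln 2 + s * l%:R = ln (2 * expR (s * l%:R)).
      by rewrite lnM ?posrE ?expR_gt0// expRK.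
    by rewrite ler_ln ?posrE ?mulr_gt0 ?expR_gt0.
  have cs : 0 < 1 - (1 - eps) * c * s.
    rewrite (_ : _ - _ = eps / (2 - eps)) ?divr_gt0//; first lra.
    by rewrite /s; field; rewrite !gt_eqF//; lra.
  by move: HN3; rewrite /x ltr_pdivrMr//; lra.
move=> L sL adm.
have lam0 : 0 <= T%:R^-1 :> R by rewrite invr_ge0 ltW.
have lamb : T%:R^-1 * b%:R = 2^-1 * l%:R^-1 :> R.
  by rewrite /T !natrM; field; rewrite !gt_eqF.
have linv : l%:R^-1 <= 1 :> R by rewrite invf_le1.
apply: le_trans (@mean_deep_cell_ge R kap T%:R^-1 l b T d L _ _ _ _ sL adm) => //.
- have -> : expR (- T%:R^-1) ^+ T = expR (-1) :> R.
    by rewrite -expRM_natr mulNr mulVf// gt_eqF.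
  have -> : (kap * expR (- (T%:R^-1 * b%:R))) ^+ l = kap ^+ l * expR (- 2^-1).
    rewrite exprMn lamb; congr (_ * _); rewrite -expRM_natr; congr expR.
    by field; rewrite gt_eqF.
  have -> : expR (- (T%:R^-1 * d%:R / 2)) ^+ T = expR (- (d%:R / 2)) :> R.
    by rewrite -expRM_natr; congr expR; field; rewrite gt_eqF.
  have dE : d%:R = 4 * l%:R + 4 :> R by rewrite natrD natrM.
  have W : 2^-1 <= 1 - 4 ^+ l * expR (- (d%:R / 2)) :> R.
    have e4 : 4 <= expR 2 :> R.
      have := @expR_ge1Dx R 1.
      have -> : 2 = 1 + 1 :> R by lra.
      by rewrite expRD; nra.
    have e4l : 4 ^+ l <= expR (2 * l%:R) :> R.
      by rewrite expRM_natr lerXn2r// nnegrE ?expR_ge0.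
    suff : 4 ^+ l * expR (- (d%:R / 2)) <= 4^-1 :> R by lra.
    have -> : - (d%:R / 2) = - (2 * l%:R) - 2 :> R by rewrite dE; lra.
    rewrite expRD mulrA.
    apply: le_trans (_ : 1 * expR (- 2) <= _).
      rewrite ler_wpM2r ?expR_ge0// expRN ler_pdivrMr ?expR_gt0//.
      by rewrite mul1r.
    by rewrite mul1r expRN lef_pV2 ?posrE ?expR_gt0.
  have M : kap * s * l%:R <= harmonic_from d b - l%:R / d%:R.
    have d0 : 0 < d%:R :> R by rewrite dE; lra.
    have : ln (b%:R / d%:R) <= harmonic_from d b :> R.
      by apply: ln_div_le_harmonic_from; rewrite ?addn_gt0 ?orbT// ltnW.
    have : l%:R / d%:R <= 4^-1 :> R by rewrite ler_pdivrMr// dE; lra.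
    rewrite ln_div ?posrE//.
    have : s * l%:R <= ln b%:R by rewrite -[leLHS]expRK ler_ln ?posrE ?expR_gt0// ltW.
    suff : ln d%:R <= (1 - kap) * s * l%:R - 4^-1 by lra.
    rewrite -ler_expR lnK ?posrE// expRD expRN.
    rewrite ler_pdivlMr ?expR_gt0//; apply: le_trans HN1.
    have : expR 4^-1 <= 2 :> R by apply: expR_le2; lra.
    by rewrite dE; nra.
  have lf0 : 0 < l`!%:R :> R by rewrite ltr0n fact_gt0.
  have ks0 : 0 < kap * s by rewrite mulr_gt0.
  set W' := 1 - _ in W *; set E := expR (s * l%:R) in bE b2E E1.
  have Egt0 : 0 < E by exact: expR_gt0.
  have lpow : expR l%:R / (expR 1 * l%:R) <= l%:R ^+ l / l`!%:R :> R.
    rewrite ler_pdivrMr ?mulr_gt0 ?expR_gt0// mulrAC ler_pdivlMr//.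
    by rewrite mulrC [leRHS]mulrC; exact: fact_le_expR.
  have P1 : (2 * E)^-1 *
      ((2 * (kap * s)) ^+ l * (expR l%:R / (expR 1 * l%:R))) <=
      cell_profile d l b.
    rewrite /cell_profile; apply: ler_pM.
    - by rewrite invr_ge0 mulr_ge0// ltW.
    - by rewrite mulr_ge0 ?exprn_ge0 ?divr_ge0 ?mulr_ge0 ?expR_ge0// ltW.
    - by rewrite lef_pV2 ?posrE ?mulr_gt0.
    apply: (@le_trans _ _ ((2 * (kap * s)) ^+ l * (l%:R ^+ l / l`!%:R))).
      by rewrite ler_wpM2l// exprn_ge0// mulr_ge0// ltW.
    have -> : (2 * (kap * s)) ^+ l * (l%:R ^+ l / l`!%:R) =
        2 ^+ l * (kap * s * l%:R) ^+ l / l`!%:R by rewrite !exprMn; ring.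
    rewrite ler_pM2r ?invr_gt0//.
    rewrite ler_wpM2l ?exprn_ge0// lerXn2r ?nnegrE ?le_max ?lexx ?M ?orbT//.
    by rewrite mulr_ge0// ltW.
  have ln2s : 2 * s = expR (ln 2 + ln s) by rewrite expRD !lnK ?posrE.
  (* By definition of [gam], [2 s exp (1 - s) = exp gam]; the two powers of [kap] take away half of
     the exponent. *)
  have G : expR (gam / 2 * l%:R) = kap ^+ l * kap ^+ l * (2 * s) ^+ l *
      (expR l%:R / E).
    rewrite expRM_natr (_ : expR l%:R / E = expR (1 - s) ^+ l); last first.
      by rewrite /E -expRB -expRM_natr mulrBl mul1r.
    rewrite -!exprMn ln2s /kap -!expRD; congr (expR _ ^+ _).
    by rewrite /gam; lra.
  have E52 : expR (5 / 2) = (expR (-1) * expR (- 2^-1) * (expR 1)^-1)^-1 :> R.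
    by rewrite -expRN -!expRD -expRN; congr expR; lra.
  have K0 : 0 <= expR (-1) * (kap ^+ l * expR (- 2^-1)) :> R.
    by rewrite !mulr_ge0 ?exprn_ge0 ?expR_ge0// ltW.
  apply: (@le_trans _ _ (expR (-1) * (kap ^+ l * expR (- 2^-1)) * 2^-1 *
      ((2 * E)^-1 *
      ((2 * (kap * s)) ^+ l * (expR l%:R / (expR 1 * l%:R)))))); last first.
    apply: ler_pM => //.
    - by rewrite mulr_ge0.
    - by rewrite !mulr_ge0 ?exprn_ge0 ?invr_ge0 ?mulr_ge0 ?expR_ge0// ltW.
    - by rewrite ler_wpM2l.
  have u1 : expR (-1) != 0 :> R by rewrite gt_eqF// expR_gt0.
  have u2 : expR (- 2^-1) != 0 :> R by rewrite gt_eqF// expR_gt0.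
  have u3 : expR 1 != 0 :> R by rewrite gt_eqF// expR_gt0.
  have lneq : l%:R != 0 :> R by rewrite gt_eqF.
  have Eneq : E != 0 by rewrite gt_eqF.
  rewrite (_ : _ * _ = expR (gam / 2 * l%:R) / (4 * l%:R * expR (5 / 2))).
    rewrite ler_pdivlMr ?mulr_gt0 ?expR_gt0//.
    by apply: le_trans HN2; rewrite le_eqVlt; apply/orP; left; apply/eqP; ring.
  rewrite G E52 (_ : (2 * (kap * s)) ^+ l = kap ^+ l * (2 * s) ^+ l); last first.
    by rewrite -exprMn; congr (_ ^+ _); ring.
  have alg (x1 x2 x3 k p y e z : R) :
      x1 != 0 -> x2 != 0 -> x3 != 0 -> e != 0 -> z != 0 ->
      x1 * (k * x2) * 2^-1 * ((2 * e)^-1 * (k * p * (y / (x3 * z)))) =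
      k * k * p * (y / e) / (4 * z * (x1 * x2 * x3^-1)^-1).
    by move=> x10 x20 x30 e0' z0; field; rewrite x10 x20 x30 e0' z0.
  exact: alg.
- exact: ltW.
- rewrite lamb; lra.
- by rewrite /d addn_gt0 orbT.
Qed.
End parameters.

(** * Void probabilities of the Poisson process *)

Definition occupied {R : realType} (X : {fset R * R}) (A : set (R * R)) : bool :=
  (0 < npoints X A)%N.

Section void_probabilities.
Context {R : realType} {d : measure_display} {Omega : measurableType d}.
Variables (P : probability Omega R) (S : set (R * R)).
Variables (Lambda : {finite_measure set (R * R)%type -> \bar R}).
Variable pts : Omega -> {fset R * R}.
Hypothesis pts_poisson : poisson_point_process P S Lambda pts.

Definition void_prob (A : set (R * R)) : R := expR (- fine (Lambda A)).

Lemma measurable_occupied (A : set (R * R)) (o : bool) : measurable A ->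
  measurable [set w | occupied (pts w) A = o].
Proof.
move=> mA; have [_ mpts _ _] := pts_poisson.
have := mpts A mA measurableT [set k | (0 < k)%N = o] I.
by rewrite setTI.
Qed.

Lemma probability_occupied (A : set (R * R)) (o : bool) :
  measurable A -> A `<=` S ->
  P [set w | occupied (pts w) A = o] =
  (if o then 1 - void_prob A else void_prob A)%:E.
Proof.
move=> mA AS; have [_ _ law _] := pts_poisson.
have void : P [set w | occupied (pts w) A = false] = (void_prob A)%:E.
  have := law A mA AS [set 0%N].
  have -> : [set w | [set 0%N] (npoints (pts w) A)] =
            [set w | occupied (pts w) A = false].
    apply/seteqP; split=> w /=; rewrite /occupied; first by move=> ->.
    by move/negbT; rewrite -leqNgt leqn0 => /eqP.
  move=> ->; rewrite /void_prob /poisson_prob.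
  have L0 : 0 <= fine (Lambda A) by rewrite fine_ge0.
  case: ifPn => [l0|]; last first.
    rewrite -leNgt => l0; rewrite (_ : fine _ = 0) ?oppr0 ?expR0.
      by rewrite diracE mem_set.
    by apply/eqP; rewrite eq_le l0.
  by rewrite esum_set1 ?lee_fin ?poisson_pmf_ge0// /poisson_pmf l0 expr0
    fact0 invr1 !mul1r.
case: o => //.
have -> : [set w | occupied (pts w) A = true] =
    ~` [set w | occupied (pts w) A = false].
  by apply/seteqP; split=> w /=; case: occupied.
rewrite probability_setC; last exact: measurable_occupied.
by rewrite void EFinB.
Qed.

Lemma measurable_occupied_all (pre : seq (set (R * R) * bool)) :
  (forall i, measurable (nth set0 (map fst pre) i)) ->
  measurable [set w | all (fun c => occupied (pts w) c.1 == c.2) pre].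
Proof.
elim: pre => [|[A o] pre IH] mpre /=.
  by rewrite (_ : [set _ | _] = setT)//; apply/seteqP; split.
have -> : [set w | (occupied (pts w) A == o) &&
      all (fun c => occupied (pts w) c.1 == c.2) pre] =
    [set w | occupied (pts w) A = o] `&`
    [set w | all (fun c => occupied (pts w) c.1 == c.2) pre].
  by apply/seteqP; split=> w /=; [move=> /andP[/eqP-> ->]|move=> [-> ->]; rewrite eqxx].
apply: measurableI; first exact: measurable_occupied (mpre 0%N).
by apply: IH => i; exact: (mpre i.+1).
Qed.

Lemma probability_occupied_all (pre : seq (set (R * R) * bool)) :
  (forall i, measurable (nth set0 (map fst pre) i) /\
             nth set0 (map fst pre) i `<=` S) ->
  trivIset setT (nth set0 (map fst pre)) ->
  P [set w | all (fun c => occupied (pts w) c.1 == c.2) pre] =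
  (\prod_(c <- pre) (if c.2 then 1 - void_prob c.1 else void_prob c.1))%:E.
Proof.
move=> mA tA; have [_ _ _ indep] := pts_poisson.
pose A (i : 'I_(size pre)) := nth set0 (map fst pre) i.
pose B (i : 'I_(size pre)) := [set k | (0 < k)%N = nth false (map snd pre) i].
have tA' : trivIset setT A.
  by move=> i j _ _ ij; apply: val_inj; exact: (tA i j I I ij).
have mA' i : measurable (A i) /\ A i `<=` S by exact: mA.
transitivity (P [set w | forall i, B i (npoints (pts w) (A i))]).
  congr (P _); apply/seteqP; split=> w /=.
    move=> /(all_nthP (set0, false)) h i.
    rewrite /B/= /A (nth_map (set0, false))// [in RHS](nth_map (set0, false))//.
    by have /eqP := h i (ltn_ord i).
  move=> h; apply/(all_nthP (set0, false)) => i isz; apply/eqP.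
  have := h (Ordinal isz).
  by rewrite /B/= /A/= (nth_map (set0, false))// [in RHS](nth_map (set0, false)).
rewrite indep// (big_nth (set0, false)) big_mkord -prodEFin.
apply: eq_bigr => i _; have [mAi AiS] := mA' i.
have := probability_occupied (nth false (map snd pre) i) mAi AiS.
by rewrite /B /A (nth_map (set0, false))// [in RHS](nth_map (set0, false)).
Qed.

(** Sets move one by one from [As] to [pre], where their state is prescribed; splitting the event on
    this state mirrors the recursion of [bernoulli_mean]. Independence enters once all states are
    prescribed. *)
Lemma probability_occupation_aux (pre : seq (set (R * R) * bool))
    (As : seq (set (R * R))) (phi : seq bool -> bool) :
  (forall i, measurable (nth set0 (map fst pre ++ As) i) /\
             nth set0 (map fst pre ++ As) i `<=` S) ->
  trivIset setT (nth set0 (map fst pre ++ As)) ->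
  let E := [set w | all (fun c => occupied (pts w) c.1 == c.2) pre &&
                    phi [seq occupied (pts w) A | A <- As]] in
  measurable E /\
  P E = (\prod_(c <- pre) (if c.2 then 1 - void_prob c.1 else void_prob c.1) *
         bernoulli_mean (map void_prob As) (fun x => (phi x)%:R))%:E.
Proof.
elim: As pre phi => [|A As IH] pre phi mAs tAs E.
  move: mAs tAs; rewrite cats0 => mAs tAs; rewrite /E /=.
  case: (phi [::]) => /=; last first.
    rewrite mulr0.
    have -> : [set w | all (fun c => occupied (pts w) c.1 == c.2) pre && false] = set0.
      by apply/seteqP; split=> w //=; rewrite andbF.
    by split; [exact: measurable0 | rewrite measure0].
  rewrite mulr1.
  have -> : [set w | all (fun c => occupied (pts w) c.1 == c.2) pre && true] =
      [set w | all (fun c => occupied (pts w) c.1 == c.2) pre].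
    by apply/seteqP; split=> w /=; rewrite andbT.
  split; last exact: probability_occupied_all.
  by apply: measurable_occupied_all => i; case: (mAs i).
pose F o := [set w | all (fun c => occupied (pts w) c.1 == c.2) (rcons pre (A, o)) &&
                    phi (o :: [seq occupied (pts w) A | A <- As])].
have FE o := IH (rcons pre (A, o)) (fun x => phi (o :: x)).
have preE o : [seq c.1 | c <- rcons pre (A, o)] ++ As =
    [seq c.1 | c <- pre] ++ A :: As.
  by rewrite map_rcons cat_rcons.
have {}FE o : _ := FE o (eq_ind_r (fun s => forall i, measurable (nth set0 s i) /\
  nth set0 s i `<=` S) mAs (preE o)) (eq_ind_r (fun s => trivIset setT (nth set0 s))
  tAs (preE o)).
have /= [mF0 PF0] := FE false; have /= [mF1 PF1] := FE true.
have -> : E = F false `|` F true.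
  apply/seteqP; split=> w; rewrite /E /F /= !all_rcons /=.
    by case: (occupied (pts w) A) => h; [right|left].
  by case=> /andP[/andP[/eqP-> ->]].
split; first exact: measurableU.
rewrite measureU//; last first.
  apply/seteqP; split=> w //; rewrite /F /= !all_rcons /=.
  by case=> /andP[/andP[/eqP->]].
apply: (etrans (congr2 (fun x y => x + y)%E PF0 PF1)).
by rewrite -EFinD; congr (_%:E); rewrite !big_rcons /=; ring.
Qed.

Lemma probability_occupation (As : seq (set (R * R))) (phi : seq bool -> bool) :
  (forall i, measurable (nth set0 As i) /\ nth set0 As i `<=` S) ->
  trivIset setT (nth set0 As) ->
  measurable [set w | phi [seq occupied (pts w) A | A <- As]] /\
  P [set w | phi [seq occupied (pts w) A | A <- As]] =
  (bernoulli_mean (map void_prob As) (fun x => (phi x)%:R))%:E.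
Proof.
move=> mAs tAs; have := @probability_occupation_aux [::] As phi mAs tAs.
by rewrite big_nil mul1r.
Qed.

End void_probabilities.

(** * From occupied cells to the height *)

Section depth_before.
Context {R : realType}.
Variable X : {fset R * R}.

Lemma lexi_le_total : total (@lexi_le R).
Proof.
move=> [a b] [c d]; rewrite /lexi_le /=.
by case: (ltgtP a c) => //= _; exact: le_total.
Qed.

Lemma lexi_le_trans : transitive (@lexi_le R).
Proof.
move=> [c d] [a b] [e f]; rewrite /lexi_le /=.
case: (ltgtP a c) => //= [ac _|<- bd].
  by case: (ltgtP c e) => //= [ce _|<- _]; rewrite ?ac// (lt_trans ac ce).
case: (ltgtP a e) => //= _; exact: le_trans.
Qed.

Lemma lexi_le_anti : antisymmetric (@lexi_le R).
Proof.
move=> [a b] [c d]; rewrite /lexi_le /=.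
by case: (ltgtP a c) => //= -> bd; congr pair; apply/eqP; rewrite eq_le.
Qed.

Definition labels_before (t : R) : seq R :=
  [seq p.2 | p <- sort lexi_le X & p.1 < t].

Definition depth_before (t v : R) : nat :=
  insertion_depth v (bst_of_seq (labels_before t)).

Lemma labels_beforeD (t t' : R) : t <= t' ->
  labels_before t' = labels_before t ++
    [seq p.2 | p <- sort lexi_le X & t <= p.1 < t'].
Proof.
move=> tt'; rewrite /labels_before -map_cat; congr map.
have : sorted lexi_le (sort lexi_le X) := sort_sorted lexi_le_total X.
elim: (sort _ _) => //= p s IH ps.
have {}IH := IH (path_sorted ps).
have [pt|tp] := ltP p.1 t.
  by rewrite (lt_le_trans pt tt') /= IH.
have noless : [seq q <- s | q.1 < t] = [::].
  apply/eqP; rewrite -(negbK (_ == _)) -has_filter; apply/hasPn => q qs.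
  have /allP/(_ q qs) := order_path_min lexi_le_trans ps.
  by rewrite /lexi_le -leNgt => /orP[/ltW|/andP[/eqP<- _]]; exact: le_trans.
by rewrite noless /= in IH *; case: ifP => _; rewrite ?IH.
Qed.

Lemma depth_before_le (t t' v : R) : t <= t' ->
  (depth_before t v <= depth_before t' v)%N.
Proof.
by move=> tt'; rewrite /depth_before (labels_beforeD tt') insertion_depth_cat.
Qed.

Lemma depth_before_lt (t t' lo hi v : R) : t <= t' -> lo <= v < hi ->
  (forall p, p \in X -> p.1 < t -> ~~ (lo <= p.2 < hi)) ->
  (exists2 p, p \in X & (t <= p.1 < t') && (lo <= p.2 < hi)) ->
  (depth_before t v < depth_before t' v)%N.
Proof.
move=> tt' vI none [p pX /andP[pt pI]].
rewrite /depth_before (labels_beforeD tt').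
apply: (insertion_depth_cat_itv vI); last first.
  by exists p.2 => //; apply: map_f; rewrite mem_filter mem_sort pt.
move=> u /mapP[q]; rewrite mem_filter mem_sort => /andP[qt qX] ->.
exact: none.
Qed.

Lemma depth_before_le_height (t v : R) :
  (depth_before t v <= (height (bst_of_points X)).+1)%N.
Proof.
apply: leq_trans (insertion_depth_le_height v _).
rewrite /bst_of_points.
(* A time strictly later than all points, so that the whole sequence has been inserted. *)
set t' := \big[Num.max/t]_(p <- sort lexi_le X) (p.1 + 1).
have tt' : t <= t' by exact: bigmax_ge_id.
have -> : [seq p.2 | p <- sort lexi_le X] = labels_before t'.
  congr map; apply/esym/all_filterP/allP => p pX.
  apply: lt_le_trans (_ : p.1 + 1 <= _); first by rewrite ltrDl.
  exact: (le_bigmax_seq _ _ xpredT (fun p => p.1 + 1)).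
exact: depth_before_le.
Qed.

Lemma occupiedP (A : set (R * R)) :
  reflect (exists2 p, p \in X & A p) (occupied X A).
Proof.
rewrite /occupied /npoints size_filter -has_count.
apply: (iffP hasP) => -[p pX pA]; exists p => //; first exact: set_mem.
exact: mem_set.
Qed.

End depth_before.

(* A cell [((t, s), (y, h))] encodes [t, t + s[ x [y, y + h[. *)
Definition rect {R : realType} (c : (R * R) * (R * R)) : set (R * R) :=
  `[c.1.1, c.1.1 + c.1.2[ `*` `[c.2.1, c.2.1 + c.2.2[.

Definition row {R : realType} (b : nat) (t s y h : R) : seq ((R * R) * (R * R)) :=
  [seq ((t, s), (y + u%:R * h, h)) | u <- iota 0 b].

Fixpoint rows {R : realType} (b T : nat) (t s y h : R) : seq ((R * R) * (R * R)) :=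
  if T is T'.+1 then row b t s y h ++ rows b T' (t + s) s y h else [::].

(* Each of the [b] strips cut out by a block of rows carries its own next block,
   whose rows last [b] times longer: the cells of all blocks have equal area. *)
Fixpoint strip_cells {R : realType} (b T g : nat) (t s y w : R) :
    seq ((R * R) * (R * R)) :=
  if g is g'.+1 then
    rows b T t s y (w / b%:R) ++
    flatten [seq strip_cells b T g' (t + T%:R * s) (s * b%:R)
               (y + j%:R * (w / b%:R)) (w / b%:R) | j <- iota 0 b]
  else [::].

Section strip_cells.
Context {R : realType}.
Implicit Types (t s y h w : R) (b T g : nat).

Lemma size_rows b T t s y h : size (rows b T t s y h) = (T * b)%N.
Proof.
by elim: T t => //= T IH t; rewrite size_cat IH size_map size_iota mulSn.
Qed.

Lemma shape_map_nseq (A B : Type) (F : A -> seq B) (r : seq A) k :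
  (forall a, size (F a) = k) -> shape (map F r) = nseq (size r) k.
Proof. by move=> Fk; elim: r => //= a r ->; rewrite Fk. Qed.

Lemma size_strip_cells b T g t s y w :
  size (strip_cells b T g t s y w) = sites b T g.
Proof.
elim: g t s y w => //= g IH t s y w.
rewrite size_cat size_rows size_flatten (@shape_map_nseq _ _ _ _ (sites b T g))//.
by rewrite size_iota sumn_nseq [(sites _ _ _ * _)%N]mulnC.
Qed.

Variable X : {fset R * R}.
Let occ (c : (R * R) * (R * R)) := occupied X (rect c).

Let clear_before t y y' := forall p, p \in X -> p.1 < t -> ~~ (y <= p.2 < y').

Lemma exists_subdivision y h (lo hi : nat) (z : R) : (lo <= hi)%N ->
  y + lo%:R * h <= z < y + hi%:R * h ->
  exists2 u, (lo <= u < hi)%N & y + u%:R * h <= z < y + u%:R * h + h.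
Proof.
move=> lohi; elim: hi lohi => [|hi IH] lohi /andP[loz zhi].
  move: lohi loz zhi; rewrite leqn0 => /eqP->.
  by move=> /le_lt_trans h1 /h1; rewrite ltxx.
have [zhi'|hiz] := ltP z (y + hi%:R * h).
  have lohi' : (lo <= hi)%N.
    move: lohi; rewrite leq_eqVlt => /orP[/eqP lohi|//].
    by move: (le_lt_trans loz zhi); rewrite lohi ltxx.
  have [|u /andP[lu uhi] uz] := IH lohi'; first by rewrite loz zhi'.
  by exists u => //; rewrite lu ltnS ltnW.
have {}lohi : (lo <= hi)%N.
  move: lohi; rewrite leq_eqVlt ltnS => /orP[/eqP lohi|//].
  by move: (le_lt_trans loz zhi); rewrite lohi ltxx.
exists hi; first by rewrite lohi ltnS leqnn.
by rewrite hiz /= (lt_le_trans zhi)// -natr1 mulrDl mul1r addrA.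
Qed.

Lemma nth_row b t s y h u x : (u < b)%N ->
  nth false ([seq occ c | c <- row b t s y h] ++ x) u =
  occ ((t, s), (y + u%:R * h, h)).
Proof.
move=> ub; rewrite nth_cat !size_map size_iota ub -map_comp.
by rewrite (nth_map 0%N) ?size_iota// nth_iota.
Qed.

(** A point of the smaller strip before [t + s] would either come before [t], which [clear]
    excludes, or occupy one of the vacant cells of the row. *)
Lemma clear_before_row b t s y h x (lo hi lo' hi' : nat) :
  (lo <= lo')%N -> (lo' <= hi')%N -> (hi' <= hi)%N -> (hi <= b)%N -> 0 <= h ->
  clear_before t (y + lo%:R * h) (y + hi%:R * h) ->
  {in iota lo' (hi' - lo'), forall i,
    nth false ([seq occ c | c <- row b t s y h] ++ x) i = false} ->
  clear_before (t + s) (y + lo'%:R * h) (y + hi'%:R * h).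
Proof.
move=> lolo' lohi' hihi' hib h0 clear vac p pX pts; apply/negP => pI.
have [tp|pt] := leP t p.1.
  have [u /andP[lou uhi] up] := exists_subdivision lohi' pI.
  have := vac u; rewrite mem_iota subnKC// lou uhi.
  rewrite nth_row ?(leq_trans uhi) ?(leq_trans hihi')//.
  move=> /(_ isT)/negP; apply; apply/occupiedP; exists p => //.
  by split; rewrite /= in_itv /= ?tp ?pts.
have /negP := clear p pX pt; apply; case/andP: pI => p1 p2; apply/andP; split.
  by apply: le_trans p1; rewrite lerD2l ler_wpM2r// ler_nat.
by apply: lt_le_trans p2 _; rewrite lerD2l ler_wpM2r// ler_nat.
Qed.

Lemma deep_cell0 b T lo hi lo' hi' j x :
  deep_cell b T 0 lo hi j x = deep_cell b T 0 lo' hi' j x.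
Proof. by elim: T x => //= T IH x; rewrite IH. Qed.

(** The gap is free of points until its first occupied row, so that row lengthens the path of every
    value in the gap, in particular of [v]. Its side of the single occupied site is again free of
    points. The first conclusion lets the next generation start. *)
Lemma deep_cell_depth b T k (lo hi j : nat) t s y h v : 0 <= s -> 0 <= h ->
  (lo <= j < hi)%N -> (hi <= b)%N ->
  clear_before t (y + lo%:R * h) (y + hi%:R * h) ->
  deep_cell b T k lo hi j [seq occ c | c <- rows b T t s y h] ->
  y + j%:R * h <= v < y + j.+1%:R * h ->
  clear_before (t + T%:R * s) (y + j%:R * h) (y + j.+1%:R * h) /\
  (depth_before X t v + k <= depth_before X (t + T%:R * s) v)%N.
Proof.
move=> s0 h0; elim: T k lo hi t => [|T IH] k lo hi t loj hib clear.
  move=> /eqP-> vj; rewrite mul0r !addr0 addn0; split=> // p pX pt.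
  apply: contra (clear p pX pt) => /andP[p1 p2]; apply/andP; split.
    by apply: le_trans p1; rewrite lerD2l ler_wpM2r// ler_nat; case/andP: loj.
  by apply: lt_le_trans p2 _; rewrite lerD2l ler_wpM2r// ler_nat; case/andP: loj.
have tT : t + T.+1%:R * s = t + s + T%:R * s by rewrite -natr1; ring.
rewrite /= map_cat drop_size_cat ?size_map ?size_iota// tT.
set rest := [seq occ c | c <- rows b T (t + s) s y h].
have ts : t <= t + s by rewrite lerDl.
have [lej jhi] := andP loj.
case: k => [|k].
  move=> /andP[vac dc] vj; rewrite addn0.
  (* Once [k = 0] only cell [j] has to stay vacant, so the gap is replaced by this cell. *)
  rewrite (deep_cell0 _ _ _ _ j j.+1) in dc.
  have clear' : clear_before (t + s) (y + j%:R * h) (y + j.+1%:R * h).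
    apply: (@clear_before_row b _ _ _ _ rest) clear _ => // i.
    rewrite mem_iota subSnn addn1 ltnS => ij.
    have -> : i = j by apply/eqP; rewrite eqn_leq andbC.
    exact: (negbTE vac).
  have [||cl le] := IH 0%N j j.+1 _ _ _ clear' dc vj.
  - by rewrite leqnn ltnS leqnn.
  - exact: leq_trans hib.
  by split=> //; rewrite addn0 in le; exact: leq_trans (depth_before_le _ _ ts) le.
move=> /orP[/andP[vac dc]|/hasP[u + /andP[oc dc]]] vj.
  have clear' : clear_before (t + s) (y + lo%:R * h) (y + hi%:R * h).
    apply: (@clear_before_row b _ _ _ _ rest) clear _ => //.
      by rewrite ltnW// (leq_ltn_trans lej).
    by move=> i iI; have /allP/(_ i iI)/negbTE := vac; exact.
  have [cl le] := IH _ lo hi _ loj hib clear' dc vj.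
  by split=> //; apply: leq_trans le; rewrite leq_add2r depth_before_le.
have lohi : (lo <= hi)%N := leq_trans lej (ltnW jhi).
rewrite mem_iota subnKC// => /andP[lou uhi].
have only i : (lo <= i < hi)%N ->
    nth false ([seq occ c | c <- row b t s y h] ++
               [seq occ c | c <- rows b T (t + s) s y h]) i = (i == u).
  move=> iI; apply/eqP; have /allP/(_ i) := oc; apply.
  by rewrite mem_iota subnKC.
have dlt : (depth_before X t v < depth_before X (t + s) v)%N.
  apply: (depth_before_lt ts _ clear).
    case/andP: vj => v1 v2; apply/andP; split.
      by apply: le_trans v1; rewrite lerD2l ler_wpM2r// ler_nat.
    by apply: lt_le_trans v2 _; rewrite lerD2l ler_wpM2r// ler_nat.
  have := only u; rewrite lou uhi eqxx nth_row ?(leq_trans uhi)// => /(_ isT).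
  move=> /occupiedP[p pX [/=]]; rewrite !in_itv /= => pt /andP[p1 p2].
  exists p => //=; rewrite pt /=; apply/andP; split.
    by apply: le_trans p1; rewrite lerD2l ler_wpM2r// ler_nat.
  apply: lt_le_trans p2 _; rewrite -[leLHS]addrA lerD2l.
  by rewrite -[X in _ + X]mul1r -mulrDl natr1 ler_wpM2r// ler_nat.
suff [cl le] : clear_before (t + s + T%:R * s) (y + j%:R * h) (y + j.+1%:R * h) /\
    (depth_before X (t + s) v + k <= depth_before X (t + s + T%:R * s) v)%N.
  by split=> //; apply: leq_trans le; rewrite addnS -addSn leq_add2r.
case/orP: dc => /andP[ju dc].
  apply: IH dc vj; rewrite ?lej ?ju ?(leq_trans (ltnW uhi))//.
  apply: (@clear_before_row b _ _ _ _ rest) clear _ => //; first exact: ltnW.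
  move=> i; rewrite mem_iota subnKC// => /andP[loi iu].
  by rewrite only ?loi ?(ltn_trans iu)// ltn_eqF.
apply: IH dc vj; rewrite ?jhi ?ju//.
apply: (@clear_before_row b _ _ _ _ rest) clear _ => //; first exact: leqW.
move=> i; rewrite mem_iota subnKC// => /andP[ui ihi].
by rewrite only ?ihi ?(leq_trans lou) ?(ltnW ui)// gtn_eqF.
Qed.

(** The value [v] is found in the last generation; it lies in all the nested strips, so the gains of
    [l] of all generations add up along its path. *)
Lemma survives_depth b T l g t s y w : (0 < b)%N -> 0 <= s -> 0 < w ->
  clear_before t y (y + w) ->
  survives b T l g [seq occ c | c <- strip_cells b T g t s y w] ->
  exists2 v, y <= v < y + w &
    (depth_before X t v + g * l <= (height (bst_of_points X)).+1)%N.
Proof.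
move=> b0 s0; elim: g t s s0 y w => [|g IH] t s s0 y w w0 clear.
  by move=> _; exists y; rewrite ?lexx ?ltrDl// addn0 depth_before_le_height.
have bR : 0 < b%:R :> R by rewrite ltr0n.
have wb : 0 < w / b%:R by rewrite divr_gt0.
rewrite /= => /hasP[j]; rewrite mem_iota => /andP[_ jb].
rewrite map_cat take_size_cat ?drop_size_cat ?size_map ?size_rows//.
move=> /andP[dc]; rewrite map_flatten -map_comp.
set ss := map _ _; have -> : nseq b (sites b T g) = shape ss.
  rewrite /ss (@shape_map_nseq _ _ _ _ (sites b T g)) ?size_iota// => i.
  by rewrite size_map size_strip_cells.
rewrite flattenK (nth_map 0%N) ?size_iota// nth_iota//= => sv.
have wE : b%:R * (w / b%:R) = w by rewrite mulrC divfK// gt_eqF.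
rewrite add0n in jb sv.
have clear' : clear_before t (y + 0%:R * (w / b%:R)) (y + b%:R * (w / b%:R)).
  by rewrite mul0r addr0 wE.
have jE : y + j.+1%:R * (w / b%:R) = y + j%:R * (w / b%:R) + w / b%:R.
  by rewrite -natr1 mulrDl mul1r addrA.
have jb' : (0 <= j < b)%N by rewrite jb.
have := @deep_cell_depth b T l 0 b j t s y (w / b%:R) _ s0 (ltW wb) jb'
    (leqnn b) clear' dc; rewrite jE => deep.
have [||v vJ dv] := IH _ _ _ _ _ wb _ sv.
- by rewrite mulr_ge0.
- have [|+ _] := deep (y + j%:R * (w / b%:R)); first by rewrite lexx ltrDl.
  by rewrite add0n.
exists v.
  case/andP: vJ => v1 v2; apply/andP; split.
    by apply: le_trans v1; rewrite lerDl mulr_ge0// ltW.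
  apply: lt_le_trans v2 _; rewrite -addrA lerD2l -{2}[w / _]mul1r -mulrDl natr1.
  by rewrite -[leRHS]wE ler_wpM2r ?ler_nat// ltW.
have [_ le] := deep v vJ.
by apply: leq_trans dv; rewrite mulSn addnA leq_add2r.
Qed.

End strip_cells.

(** * Geometry of the cells *)

Section cell_geometry.
Context {R : realType}.
Implicit Types (c : (R * R) * (R * R)) (t s y h w : R).

Definition in_box (t t' y y' : R) c : bool :=
  [&& t <= c.1.1, c.1.1 + c.1.2 <= t', y <= c.2.1 & c.2.1 + c.2.2 <= y'].

(** Oriented on purpose: cells are listed so that later ones lie further right or higher, which
    suits [pairwise]. *)
Definition apart : rel ((R * R) * (R * R)) := fun c c' =>
  (c.1.1 + c.1.2 <= c'.1.1) || (c.2.1 + c.2.2 <= c'.2.1).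

Lemma apart_disjoint c c' : apart c c' -> rect c `&` rect c' = set0.
Proof.
move=> cc'; apply/seteqP; split=> // -[x z] [] [] /=.
rewrite !in_itv /= => /andP[? ?] /andP[? ?] [] /=.
rewrite !in_itv /= => /andP[? ?] /andP[? ?].
by case/orP: cc' => ?; lra.
Qed.

Lemma pairwise_apart_trivIset (s : seq ((R * R) * (R * R))) :
  pairwise apart s -> trivIset setT (nth set0 (map rect s)).
Proof.
move=> /(pairwiseP ((0, 0), (0, 0))) sap.
have disj i j : (i < j)%N ->
    nth set0 (map rect s) i `&` nth set0 (map rect s) j = set0.
  move=> ij; have [js|sj] := ltnP j (size s); last first.
    by rewrite [X in _ `&` X]nth_default ?size_map// setI0.
  have is' := ltn_trans ij js.
  by rewrite !(nth_map ((0, 0), (0, 0)))//; apply: apart_disjoint; exact: sap.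
apply/trivIsetP => i j _ _; rewrite neq_ltn => /orP[|ji]; first exact: disj.
by rewrite setIC; exact: disj.
Qed.

Lemma rows_box b T t s y h : 0 <= s -> 0 <= h ->
  all (in_box t (t + T%:R * s) y (y + b%:R * h)) (rows b T t s y h).
Proof.
move=> s0 h0; elim: T t => //= T IH t; rewrite all_cat; apply/andP; split.
  apply/allP => c /mapP[u]; rewrite mem_iota => /andP[_ ub] ->.
  rewrite /in_box /= lexx lerDl mulr_ge0//= -natr1 mulrDl mul1r.
  have -> /= : t + s <= t + (T%:R * s + s) by rewrite lerD2l lerDr mulr_ge0.
  rewrite -addrA lerD2l -[X in _ + X]mul1r -mulrDl natr1 ler_wpM2r//.
  by rewrite ler_nat.
apply: sub_all (IH _) => c /and4P[tc ct yc cy]; apply/and4P; split=> //.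
  by apply: le_trans tc; rewrite lerDl.
by apply: le_trans ct _; rewrite -natr1; lra.
Qed.

Lemma rows_apart b T t s y h : 0 <= s -> 0 <= h ->
  pairwise apart (rows b T t s y h).
Proof.
move=> s0 h0; elim: T t => //= T IH t; rewrite pairwise_cat IH andbT.
apply/andP; split.
  apply/allrelP => c c' /mapP[u _ ->] c'r; apply/orP; left => /=.
  by have /allP/(_ _ c'r)/and4P[] := @rows_box b T (t + s) s y h s0 h0.
rewrite /row; elim: b 0%N {IH} => //= b IHb n; rewrite IHb andbT.
apply/allP => c /mapP[u]; rewrite mem_iota => /andP[nu _] ->.
apply/orP; right => /=.
rewrite -addrA lerD2l -[X in _ + X]mul1r -mulrDl natr1 ler_wpM2r//.
by rewrite ler_nat.
Qed.

Lemma flatten_apart (F : nat -> seq ((R * R) * (R * R))) (t t' y w : R) n m :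
  0 <= w -> (forall j, pairwise apart (F j)) ->
  (forall j, all (in_box t t' (y + j%:R * w) (y + j%:R * w + w)) (F j)) ->
  pairwise apart (flatten [seq F j | j <- iota n m]).
Proof.
move=> w0 Fap Fbox; elim: m n => //= m IH n.
rewrite pairwise_cat Fap IH !andbT; apply/allrelP => c c' cF.
move=> /flattenP[? /mapP[j]]; rewrite mem_iota => /andP[nj _] -> c'F.
apply/orP; right.
have /allP/(_ _ cF)/and4P[_ _ _ cy] := Fbox n.
have /allP/(_ _ c'F)/and4P[_ _ yc' _] := Fbox j.
apply: le_trans cy (le_trans _ yc').
rewrite -addrA lerD2l -[X in _ + X]mul1r -mulrDl natr1 ler_wpM2r//.
by rewrite ler_nat.
Qed.

Lemma flatten_box (F : nat -> seq ((R * R) * (R * R))) (t t' y w : R) m :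
  0 <= w ->
  (forall j, all (in_box t t' (y + j%:R * w) (y + j%:R * w + w)) (F j)) ->
  all (in_box t t' y (y + m%:R * w)) (flatten [seq F j | j <- iota 0 m]).
Proof.
move=> w0 Fbox; apply/allP => c /flattenP[? /mapP[j]].
rewrite mem_iota => /andP[_ jm] -> cF.
have /allP/(_ _ cF)/and4P[tc ct yc cy] := Fbox j; apply/and4P; split=> //.
  by apply: le_trans yc; rewrite lerDl mulr_ge0.
apply: le_trans cy _.
rewrite -addrA lerD2l -[X in _ + X]mul1r -mulrDl natr1 ler_wpM2r//.
by rewrite ler_nat.
Qed.

Fixpoint duration (b T g : nat) (s : R) : R :=
  if g is g'.+1 then T%:R * s + duration b T g' (s * b%:R) else 0.

Lemma duration_ge0 b T g s : 0 <= s -> 0 <= duration b T g s.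
Proof.
by elim: g s => //= g IH s s0; rewrite addr_ge0 ?mulr_ge0// IH// mulr_ge0.
Qed.

Lemma duration_le b T g s : (1 < b)%N -> 0 <= s ->
  duration b T g s <= T%:R * s * b%:R ^+ g.
Proof.
(* The induction needs the sharper bound with [b ^ g - 1], whose step uses [b >= 2]. *)
move=> b1; suff h s' : 0 <= s' ->
    duration b T g s' <= T%:R * s' * (b%:R ^+ g - 1).
  move=> s0; apply: le_trans (h _ s0) _; rewrite ler_wpM2l ?mulr_ge0//.
  by rewrite gerBl.
elim: g s' => [|g IH] s' s0 /=; first by rewrite expr0 subrr mulr0.
apply: (le_trans (lerD (lexx _) (IH _ _))); first by rewrite mulr_ge0.
have b2 : 2 <= b%:R :> R by rewrite ler_nat.
have Ts : 0 <= T%:R * s' by rewrite mulr_ge0.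
rewrite exprS; have : 0 <= T%:R * s' * (b%:R - 2) by rewrite mulr_ge0// subr_ge0.
lra.
Qed.

Lemma strip_cells_box b T g t s y w : (0 < b)%N -> 0 <= s -> 0 <= w ->
  all (in_box t (t + duration b T g s) y (y + w)) (strip_cells b T g t s y w).
Proof.
move=> b0; elim: g t s y w => //= g IH t s y w s0 w0.
have bR : b%:R != 0 :> R by rewrite pnatr_eq0 -lt0n.
have wb : 0 <= w / b%:R by rewrite divr_ge0.
have wE : b%:R * (w / b%:R) = w by rewrite mulrC divfK.
have sb : 0 <= s * b%:R by rewrite mulr_ge0.
rewrite all_cat; apply/andP; split.
  have := @rows_box b T t s y _ s0 wb; rewrite wE; apply: sub_all.
  move=> c /and4P[tc ct yc cy]; apply/and4P; split=> //.
  by apply: le_trans ct _; rewrite addrA lerDl duration_ge0.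
have := @flatten_box _ (t + T%:R * s)
  (t + T%:R * s + duration b T g (s * b%:R)) y (w / b%:R) b wb
  (fun j => IH _ _ _ _ sb wb); rewrite wE; apply: sub_all.
move=> c /and4P[tc ct yc cy]; apply/and4P; split=> //; last by rewrite addrA.
by apply: le_trans tc; rewrite lerDl mulr_ge0.
Qed.

Lemma strip_cells_apart b T g t s y w : (0 < b)%N -> 0 <= s -> 0 <= w ->
  pairwise apart (strip_cells b T g t s y w).
Proof.
move=> b0; elim: g t s y w => //= g IH t s y w s0 w0.
have wb : 0 <= w / b%:R by rewrite divr_ge0.
have sb : 0 <= s * b%:R by rewrite mulr_ge0.
rewrite pairwise_cat rows_apart//=; apply/andP; split.
  apply/allrelP => c c' cr c'F; apply/orP; left.
  have /allP/(_ _ cr)/and4P[_ ct _ _] := @rows_box b T t s y _ s0 wb.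
  apply: le_trans ct _; move: c'F => /flattenP[? /mapP[j _ ->] c'F].
  by have /and4P[] := allP (@strip_cells_box b T g _ _ _ _ b0 sb wb) _ c'F.
apply: (@flatten_apart _ (t + T%:R * s)
  (t + T%:R * s + duration b T g (s * b%:R)) y _ _ _ wb) => j.
  exact: IH _ _ _ _ sb wb.
exact: strip_cells_box b0 sb wb.
Qed.

Definition has_area (a : R) c : bool :=
  [&& 0 < c.1.2, 0 < c.2.2 & c.1.2 * c.2.2 == a].

Lemma strip_cells_area b T g t s y w : (0 < b)%N -> 0 < s -> 0 < w ->
  all (has_area (s * (w / b%:R))) (strip_cells b T g t s y w).
Proof.
move=> b0; have bR : 0 < b%:R :> R by rewrite ltr0n.
elim: g t s y w => //= g IH t s y w s0 w0.
have wb : 0 < w / b%:R by rewrite divr_gt0.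
have sb : 0 < s * b%:R by rewrite mulr_gt0.
rewrite all_cat; apply/andP; split.
  elim: T t {IH} => //= T IH t; rewrite all_cat IH andbT.
  by apply/allP => c /mapP[u _ ->]; rewrite /has_area /= s0 wb eqxx.
apply/allP => c /flattenP[? /mapP[j _ ->] cF].
have := IH (t + T%:R * s) (s * b%:R) (y + j%:R * (w / b%:R)) (w / b%:R) sb wb.
rewrite -mulrA [b%:R * _]mulrCA divff ?gt_eqF// mulr1 => /allP; exact.
Qed.

Lemma measurable_rect c : measurable (rect c).
Proof. by apply: measurableX; exact: measurable_itv. Qed.

End cell_geometry.

(** * Cells near (0, y) *)

(** The density [rho] carries no measurability assumption. The integral of a nonnegative function is
    a supremum over the simple functions below it, hence monotone all the same. *)
Lemma ge0_le_integral_nonmeasurable {d : measure_display} {T : measurableType d}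
    {R : realType} (m : {measure set T -> \bar R}) (D : set T) (f g : T -> \bar R) :
  (forall x, D x -> 0 <= f x)%E -> (forall x, D x -> f x <= g x)%E ->
  (\int[m]_(x in D) f x <= \int[m]_(x in D) g x)%E.
Proof.
move=> f0 fg; have g0 x : D x -> (0 <= g x)%E.
  by move=> Dx; apply: le_trans (f0 _ Dx) (fg _ Dx).
rewrite !ge0_integralE//; apply: le_ereal_sup => _ [h /= hf <-].
exists h => // x; apply: le_trans (hf x) _.
by rewrite /patch; case: ifPn => // /set_mem; exact: fg.
Qed.

Section density.
Context {R : realType}.

Lemma rect_measure (c : (R * R) * (R * R)) : 0 < c.1.2 -> 0 < c.2.2 ->
  ((lebesgue_measure \x lebesgue_measure) (rect c) = (c.1.2 * c.2.2)%:E)%E.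
Proof.
move=> c1 c2; rewrite product_measure1E//.
pose A : set R := [set` `[c.1.1, c.1.1 + c.1.2[].
pose B : set R := [set` `[c.2.1, c.2.1 + c.2.2[].
transitivity (lebesgue_measure A * lebesgue_measure B)%E => //.
rewrite !lebesgue_measure_itv/= !lte_fin !ltrDl c1 c2.
by rewrite -!EFinB -EFinM; congr (_ * _)%:E; rewrite addrAC subrr add0r.
Qed.

Lemma density_near_rectangle (mu : probability (R * R)%type R) (y kap : R) :
  0 <= y <= 1 -> has_continuous_positive_density_near mu (0, y) ->
  0 < kap < 1 ->
  exists rho a y1 y2 : R, [/\ 0 < rho, 0 < a, y1 < y2 &
    forall (s : R) c, in_box 0 a y1 y2 c -> has_area s c ->
      rect c `<=` unit_square R /\ kap * (rho * s) <= fine (mu (rect c)) <= rho * s].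
Proof.
move=> y01 [U [rho [US nU crho rho0 muU]]] /andP[k0 k1].
have y0 : unit_square R (0, y) by split; rewrite /= in_itv /= ?lexx ?ler01.
have U0 : U (0, y).
  by have := nbhs_singleton nU; exact.
pose r0 := rho (0, y); have r00 : 0 < r0 by exact: rho0.
(* Solves [kap * (r0 + e) = r0 - e]: the bounds on the density near the point then differ by the
   factor [kap]. *)
pose e := r0 * (1 - kap) / (1 + kap).
have e0 : 0 < e by rewrite divr_gt0 ?mulr_gt0 ?subr_gt0 ?addr_gt0.
have near_rho : \forall q \near (0, y), U q -> `|r0 - rho q| < e.
  have /subspace_continuousP/(_ _ U0) := crho.
  move=> /cvgrPdist_lt/(_ _ e0); exact.
have : \forall q \near ((0, y) : R * R),
    unit_square R q -> U q /\ `|r0 - rho q| < e.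
  have nU' : \forall q \near ((0, y) : R * R), unit_square R q -> U q by [].
  by apply: filterS2 nU' near_rho => q SU Ur qS; split; [|apply: Ur]; exact: SU.
move=> /nbhs_ballP[r /= rpos ballr].
(* Clipping at 0 and 1 keeps the box in the unit square; it stays nondegenerate even when [y] is 0
   or 1. *)
exists (r0 + e), (Num.min r 1 / 2), (Num.max 0 (y - r / 2)), (Num.min 1 (y + r / 2)).
have [y_ge0 y_le1] := andP y01.
split; first by rewrite addr_gt0.
- by rewrite divr_gt0// lt_min rpos ltr01.
- by rewrite lt_min !gt_max; apply/andP; split; apply/andP; split; lra.
move=> s c /and4P[tc ct yc cy] /and3P[c1 c2 /eqP cs].
have inball q : rect c q -> unit_square R q /\ ball ((0, y) : R * R) r q.
  case: q => q1 q2 [] /=; rewrite !in_itv /= => /andP[h1 h2] /andP[h3 h4].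
  have : Num.min r 1 <= r by rewrite ge_min lexx.
  have : Num.min r 1 <= 1 by rewrite ge_min lexx orbT.
  have : 0 <= Num.max 0 (y - r / 2) by rewrite le_max lexx.
  have : y - r / 2 <= Num.max 0 (y - r / 2) by rewrite le_max lexx orbT.
  have : Num.min 1 (y + r / 2) <= 1 by rewrite ge_min lexx.
  have : Num.min 1 (y + r / 2) <= y + r / 2 by rewrite ge_min lexx orbT.
  move: (Num.min _ _) (Num.max _ _) (Num.min _ _) tc ct yc cy => z1 z2 z3.
  move=> tc ct yc cy g1 g2 g3 g4 g5 g6; split.
    by split; rewrite /= in_itv /=; lra.
  by split; rewrite /= -ball_normE /ball_ /= ltr_norml; lra.
have near_c q : rect c q -> U q /\ `|r0 - rho q| < e.
  by move=> /inball[qS qr]; exact: ballr.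
split; first by move=> q /inball[].
have cU : rect c `<=` U by move=> q /near_c[].
rewrite (muU _ (measurable_rect c) cU).
have bounds q : rect c q -> r0 - e <= rho q <= r0 + e.
  by move=> /near_c[_]; rewrite ltr_norml; lra.
have e1 : kap * (r0 + e) = r0 - e.
  by rewrite /e; field; rewrite gt_eqF// addr_gt0.
have re0 : 0 < r0 - e by rewrite -e1 mulr_gt0// addr_gt0.
have lo : ((kap * ((r0 + e) * s))%:E <=
    \int[lebesgue_measure \x lebesgue_measure]_(q in rect c) (rho q)%:E)%E.
  rewrite mulrA e1 EFinM -cs -(rect_measure c1 c2).
  rewrite -integral_cst; last exact: measurable_rect.
  apply: ge0_le_integral_nonmeasurable => q qc; rewrite /= lee_fin; first exact: ltW.
  by have /andP[] := bounds _ qc.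
have hi : (\int[lebesgue_measure \x lebesgue_measure]_(q in rect c) (rho q)%:E <=
    ((r0 + e) * s)%:E)%E.
  rewrite EFinM -cs -(rect_measure c1 c2).
  rewrite -integral_cst; last exact: measurable_rect.
  apply: ge0_le_integral_nonmeasurable => q qc; rewrite /= lee_fin.
    by apply/ltW/rho0; exact: cU.
  by have /andP[] := bounds _ qc.
rewrite -!lee_fin fineK ?lo ?hi// fin_numElt.
by rewrite (lt_le_trans (ltNyr _) lo) (le_lt_trans hi (ltry _)).
Qed.

End density.

(** * Measurability of the height *)

Fixpoint map_btree {T U : Type} (f : T -> U) (t : btree T) : btree U :=
  if t is BNode l u r then BNode (map_btree f l) (f u) (map_btree f r)
  else BEmpty.

Lemma leaf_depths_map {T U : Type} (f : T -> U) (t : btree T) :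
  leaf_depths (map_btree f t) = leaf_depths t.
Proof.
elim: t => // l IHl u r IHr.
rewrite -[map_btree f _]/(BNode (map_btree f l) (f u) (map_btree f r)).
by rewrite !leaf_depths_node IHl IHr.
Qed.

Section rounding.
Context {R : realType}.

(** Insertion only compares values, so it commutes with an order-preserving relabeling. *)
Lemma bst_of_seq_map (f : R -> R) (s : seq R) :
  {in s &, {mono f : x y / x < y}} ->
  bst_of_seq (map f s) = map_btree f (bst_of_seq s).
Proof.
elim/last_ind: s => // s v IH fm.
have fs : {in s &, {mono f : x y / x < y}}.
  by move=> x y xs ys; apply: fm; rewrite mem_rcons inE ?xs ?ys orbT.
rewrite map_rcons /bst_of_seq !foldl_rcons -/(bst_of_seq _) IH//.
have fv : {in btree_labels (bst_of_seq s), forall u, (f v < f u) = (v < u)}.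
  move=> u; rewrite mem_bst_of_seq => us; apply: fm.
    by rewrite mem_rcons mem_head.
  by rewrite mem_rcons inE us orbT.
rewrite -/(bst_of_seq s); elim: (bst_of_seq s) fv => //= l IHl u r IHr fv.
rewrite fv ?mem_cat ?inE ?eqxx ?orbT//.
by case: ifP => _ /=; rewrite ?IHl ?IHr// => x xin; apply: fv;
  rewrite mem_cat inE xin ?orbT.
Qed.

Definition round (m : nat) (p : R * R) : nat * nat :=
  (Num.truncn (m%:R * p.1), Num.truncn (m%:R * p.2)).

Definition of_grid (c : nat * nat) : R * R := (c.1%:R, c.2%:R).

Definition point_height (s : seq (R * R)) : nat :=
  height (bst_of_seq [seq p.2 | p <- sort lexi_le s]).

Lemma truncn_lt_eventually (s : seq R) : {in s, forall x, 0 <= x} ->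
  exists N, forall m, (N <= m)%N ->
    {in s &, {mono (fun x => Num.truncn (m%:R * x)) : x y /
      x < y >-> (x < y)%N}}.
Proof.
move=> s0; pose N := (\max_(x <- s) \max_(y <- s) Num.bound (y - x)^-1)%N.
exists N => m Nm x y xs ys.
have m0 z : z \in s -> 0 <= m%:R * z by move=> zs; rewrite mulr_ge0// s0.
have [xy|yx] := ltP x y; last first.
  by apply/negbTE; rewrite -leqNgt; apply: le_truncn; rewrite ler_wpM2l.
have xym : 1 < m%:R * (y - x).
  have yx0 : 0 < y - x by rewrite subr_gt0.
  rewrite -ltr_pdivrMr// mul1r.
  apply: lt_le_trans (archi_boundP _) _; first by rewrite invr_ge0 ltW.
  rewrite ler_nat; apply: leq_trans Nm.
  rewrite /N (big_rem x xs)/=; apply: leq_trans (leq_maxl _ _).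
  by rewrite (big_rem y ys)/=; exact: leq_maxl.
rewrite truncn_gt_nat -natr1.
have : (Num.truncn (m%:R * x))%:R <= m%:R * x by rewrite truncn_le m0.
by lra.
Qed.

(** A fine enough grid preserves strict order and ties in both coordinates, hence the lexicographic
    order and the shape of the tree. [g] is any enumeration of the rounded points, since sorting by
    a total antisymmetric order forgets it. *)
Lemma point_height_round (s : seq (R * R)) :
  {in s, forall p, 0 <= p.1 /\ 0 <= p.2} ->
  exists N, forall m, (N <= m)%N -> forall g : seq (nat * nat),
    uniq g -> uniq s -> g =i [seq round m p | p <- s] ->
    point_height (map of_grid g) = point_height s.
Proof.
move=> s0.
have [|N1 HN1] := @truncn_lt_eventually (map fst s).
  by move=> _ /mapP[p ps ->]; case: (s0 _ ps).
have [|N2 HN2] := @truncn_lt_eventually (map snd s).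
  by move=> _ /mapP[p ps ->]; case: (s0 _ ps).
exists (maxn N1 N2) => m; rewrite geq_max => /andP[N1m N2m] g ug us gs.
have lt1 : {in s &, forall p q, (of_grid (round m p)).1 < (of_grid (round m q)).1
    = (p.1 < q.1)}.
  by move=> p q ps qs; rewrite /= ltr_nat; apply: HN1 => //; exact: map_f.
have lt2 : {in s &, forall p q, (of_grid (round m p)).2 < (of_grid (round m q)).2
    = (p.2 < q.2)}.
  by move=> p q ps qs; rewrite /= ltr_nat; apply: HN2 => //; exact: map_f.
have lexi : {in s &, {mono (of_grid \o round m) : p q / lexi_le p q}}.
  move=> p q ps qs; rewrite /lexi_le !eq_le !leNgt.
  by rewrite /= in lt1 lt2 *; rewrite !lt1 ?lt2.
have inj : {in s &, injective (of_grid \o round m)}.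
  move=> p q ps qs pq; apply: lexi_le_anti.
  rewrite -(lexi p q ps qs) -(lexi q p qs ps) pq.
  by rewrite /lexi_le !lexx eqxx orbT.
have perm : perm_eq (map of_grid g) (map (of_grid \o round m) s).
  apply: uniq_perm; rewrite ?map_inj_in_uniq//.
    by move=> [a b] [c d] _ _ [] /eqP + /eqP; rewrite !eqr_nat => /eqP-> /eqP->.
  move=> p; rewrite map_comp; apply/mapP/mapP => -[c cg ->]; exists c => //.
    by rewrite -gs.
  by rewrite gs.
rewrite /point_height; have /perm_sortP -> // := perm; last first.
- exact: lexi_le_anti.
- exact: lexi_le_trans.
- exact: lexi_le_total.
have -> : sort lexi_le (map (of_grid \o round m) s) =
    map (of_grid \o round m) (sort lexi_le s).
  apply: (sorted_eq lexi_le_trans lexi_le_anti).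
  - exact: sort_sorted lexi_le_total _.
  - apply: (@homo_sorted_in _ _ (mem s) _ lexi_le).
    + by move=> p q ps qs; rewrite lexi.
    + by apply/allP => p; rewrite mem_sort.
    + exact: sort_sorted lexi_le_total _.
  by rewrite perm_sort perm_map// perm_sym perm_sort.
pose f (y : R) : R := (Num.truncn (m%:R * y))%:R.
have -> : [seq p.2 | p <- [seq (of_grid \o round m) i | i <- sort lexi_le s]] =
    [seq f y | y <- [seq p.2 | p <- sort lexi_le s]].
  by rewrite -!map_comp.
rewrite bst_of_seq_map /height ?leaf_depths_map// => y z.
move=> /mapP[p]; rewrite mem_sort => ps ->.
by move=> /mapP[q]; rewrite mem_sort => qs ->; exact: lt2.
Qed.

End rounding.

Section measurable_height.
Context {R : realType} {d : measure_display} {Omega : measurableType d}.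
Variables (P : probability Omega R).
Variables (Lambda : {finite_measure set (R * R)%type -> \bar R}).
Variable pts : Omega -> {fset R * R}.
Hypothesis pts_poisson : poisson_point_process P (unit_square R) Lambda pts.

Definition grid_cell (m : nat) (c : nat * nat) : (R * R) * (R * R) :=
  ((c.1%:R / m%:R, m%:R^-1), (c.2%:R / m%:R, m%:R^-1)).

Lemma grid_cellP (m : nat) (c : nat * nat) (p : R * R) : (0 < m)%N ->
  0 <= p.1 -> 0 <= p.2 -> rect (grid_cell m c) p <-> round m p = c.
Proof.
move=> m0 p1 p2; have mR : 0 < m%:R :> R by rewrite ltr0n.
have side (x : R) (n : nat) : 0 <= x ->
    (n%:R / m%:R <= x < n%:R / m%:R + m%:R^-1) = (Num.truncn (m%:R * x) == n).
  move=> x0; rewrite truncn_eq ?mulr_ge0// ler_pdivrMr// [x * _]mulrC.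
  by rewrite -[X in _ + X]mul1r -mulrDl natr1 ltr_pdivlMr// [x * _]mulrC.
rewrite /rect /round; case: c => i j; split.
  by move=> [] /=; rewrite !in_itv /= !side// => /eqP-> /eqP->.
by move=> [<- <-]; split; rewrite /= in_itv /= side.
Qed.

(** Indices go up to [m] because a coordinate equal to 1 is rounded to [m]. *)
Definition occupied_grid (m : nat) (w : Omega) : {set 'I_m.+1 * 'I_m.+1} :=
  [set c : 'I_m.+1 * 'I_m.+1 |
    occupied (pts w) (rect (grid_cell m (val c.1, val c.2)))].

Definition grid_seq (m : nat) (S : {set 'I_m.+1 * 'I_m.+1}) : seq (nat * nat) :=
  [seq (val c.1, val c.2) | c <- enum S].

Lemma height_rounded (w : Omega) : exists N, forall m, (N <= m)%N ->
  point_height (map (@of_grid R) (grid_seq (occupied_grid m w))) =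
  height (bst_of_points (pts w)).
Proof.
have [ptsS _ _ _] := pts_poisson.
have pos : {in pts w, forall p, 0 <= p.1 /\ 0 <= p.2}.
  by move=> p /ptsS[] /=; rewrite !in_itv /= => /andP[-> _] /andP[-> _].
have [N HN] := point_height_round pos; exists N.+1 => m Nm.
have m0 : (0 < m)%N by exact: leq_ltn_trans Nm.
rewrite /bst_of_points -/(point_height _); apply: (HN m) => //; first exact: ltnW.
- rewrite map_inj_in_uniq ?enum_uniq// => -[i j] [k l] _ _ /= [ik jl].
  by congr pair; exact: val_inj.
- exact: fset_uniq.
move=> c; apply/mapP/mapP => [[[i j]]|[p pX ->]].
  rewrite mem_enum inE /= => /occupiedP[p pX pc] ->; exists p => //.
  have [p1 p2] := pos _ pX.
  exact/esym/(grid_cellP (_, _) m0 p1 p2).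
have [p1 p2] := pos _ pX.
have lem (x : R) : 0 <= x <= 1 -> (Num.truncn (m%:R * x) < m.+1)%N.
  move=> /andP[x0 x1]; rewrite ltnS truncn_le_nat -natr1.
  have : m%:R * x <= m%:R by rewrite ler_piMr.
  by lra.
have [/= + +] := ptsS _ _ pX; rewrite !in_itv /= => p11 p21.
exists (Ordinal (lem _ p11), Ordinal (lem _ p21)) => //.
rewrite mem_enum inE /=; apply/occupiedP; exists p => //.
exact/grid_cellP.
Qed.

Lemma measurable_occupied_grid (m : nat) (C : set {set 'I_m.+1 * 'I_m.+1}) :
  measurable [set w | C (occupied_grid m w)].
Proof.
have -> : [set w | C (occupied_grid m w)] =
    \bigcup_(S in C) [set w | occupied_grid m w = S].
  apply/seteqP; split=> w /= => [Cw|[S CS ->]//].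
  by exists (occupied_grid m w).
apply: fin_bigcup_measurable => [|S _]; first exact: finite_finset.
pose pre := [seq (rect (grid_cell m (val c.1, val c.2)), c \in S) |
              c <- enum {: 'I_m.+1 * 'I_m.+1}].
have -> : [set w | occupied_grid m w = S] =
    [set w | all (fun c => occupied (pts w) c.1 == c.2) pre].
  apply/seteqP; split=> w /=.
    by move=> wS; rewrite all_map; apply/allP => c _ /=; rewrite -wS inE.
  rewrite all_map => /allP h; apply/setP => c; rewrite inE.
  by have /= := h c; rewrite mem_enum => /(_ isT)/eqP.
apply: (measurable_occupied_all pts_poisson) => i.
have [isz|szi] := ltnP i (size pre); last by rewrite nth_default// size_map.
rewrite -map_comp (nth_map (ord0, ord0)); last by rewrite size_map in isz.
exact: measurable_rect.
Qed.

(* The height is the limit of the heights of the trees of the points rounded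
   to finer and finer grids, which depend on finitely many counts each. *)
Lemma measurable_height (B : set nat) :
  measurable [set w | B (height (bst_of_points (pts w)))].
Proof.
pose H m w := point_height (map (@of_grid R) (grid_seq (occupied_grid m w))).
have -> : [set w | B (height (bst_of_points (pts w)))] =
    \bigcup_N \bigcap_(m in [set m | (N <= m)%N]) [set w | B (H m w)].
  apply/seteqP; split=> w /=.
    move=> Bw; have [N HN] := height_rounded w.
    by exists N => // m /= Nm; rewrite /H HN.
  move=> [N _ hN]; have [M HM] := height_rounded w.
  rewrite -(HM (maxn N M)) ?leq_maxr//; apply: (hN (maxn N M)).
  exact: leq_maxl.
apply: bigcupT_measurable => N; apply: bigcap_measurable => [|m _].
  by exists N => /=.
apply: (measurable_occupied_grid
  [set S | B (point_height (map (@of_grid R) (grid_seq S)))]).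
Qed.

End measurable_height.

(** * Lower bound on the height *)

Lemma mean_no_survivor {R : realFieldType} (a q : R) (b T l g : nat)
    (Ls : seq (seq R)) : 0 <= a -> (0 < b)%N ->
  (forall L, size L = (T * b)%N -> admissible a q L ->
     2 <= \sum_(0 <= j < b)
       bernoulli_mean L (fun x => (deep_cell b T l 0 b j x)%:R)) ->
  {in Ls, forall L, size L = sites b T g /\ admissible a q L} ->
  bernoulli_mean (flatten Ls) (fun x =>
    (all (fun j => ~~ survives b T l g (nth [::] (reshape (shape Ls) x) j))
         (iota 0 (size Ls)))%:R) <= (1 - b%:R^-1) ^+ size Ls.
Proof.
move=> a0 b0 two admLs.
have -> : bernoulli_mean (flatten Ls) (fun x =>
    (all (fun j => ~~ survives b T l g (nth [::] (reshape (shape Ls) x) j))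
         (iota 0 (size Ls)))%:R) =
  bernoulli_mean (flatten Ls) (fun x => \prod_(j < size Ls)
    (~~ survives b T l g (nth [::] (reshape (shape Ls) x) j))%:R).
  apply: bernoulli_mean_eq => x _; have [/allP h|/allPn[j]] := boolP (all _ _).
    by rewrite big1// => j _; rewrite h// mem_iota /=.
  rewrite mem_iota => /andP[_ jm]; rewrite negbK => sj.
  by rewrite (bigD1 (Ordinal jm))//= sj mul0r.
rewrite (bernoulli_mean_flatten _ (fun=> fun y => (~~ survives b T l g y)%:R)).
rewrite -[X in _ <= _ ^+ X]card_ord -prodr_const; apply: ler_prod => j _.
have [szj admj] := admLs _ (mem_nth [::] (ltn_ord j)).
set L := nth [::] Ls j in szj admj *.
have e : bernoulli_mean L (fun x => (~~ survives b T l g x)%:R) =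
    1 - bernoulli_mean L (fun x => (survives b T l g x)%:R).
  apply/eqP; rewrite eq_sym subr_eq -bernoulli_meanD.
  rewrite -[X in X == _](bernoulli_mean_cst L); apply/eqP.
  by apply: bernoulli_mean_eq => x _; case: survives; rewrite ?add0r ?addr0.
apply/andP; split.
  by apply: bernoulli_mean_ge0 (admissible01 a0 admj) _ => x; rewrite ler0n.
by rewrite e lerD2l lerN2; exact: (mean_survives a0 b0 two szj admj).
Qed.

(** For [z = kap * lam], [1 - exp (- x) >= 1 - exp (- z) >= z exp (- z) >= z exp (- lam)]. *)
Lemma admissible_void_prob {R : realType} (kap lam x : R) :
  0 <= kap -> 0 <= lam -> kap * lam <= x <= lam ->
  (expR (- lam) <= expR (- x) <= 1) &&
  (kap * lam * expR (- lam) <= 1 - expR (- x)).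
Proof.
move=> kap0 lam0 /andP[kx xl].
have y0 : 0 <= kap * lam by exact: mulr_ge0.
rewrite ler_expR lerN2 xl expR_le1 oppr_le0 (le_trans y0 kx) /=.
have h1 : expR (- x) <= expR (- (kap * lam)) by rewrite ler_expR lerN2.
have h2 : expR (- lam) <= expR (- (kap * lam)).
  by rewrite ler_expR lerN2 (le_trans kx).
have h3 : (1 + kap * lam) * expR (- (kap * lam)) <= 1.
  by rewrite expRN ler_pdivrMr ?expR_gt0// mul1r expR_ge1Dx.
have := ler_wpM2l y0 h2; lra.
Qed.

Section low_height.
Context {R : realType} {d : measure_display} {Omega : measurableType d}.
Variables (P : probability Omega R) (mu : probability (R * R)%type R).
Variables (Lambda : {finite_measure set (R * R)%type -> \bar R}) (n : nat).
Variable pts : Omega -> {fset R * R}.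
Hypothesis n0 : (0 < n)%N.
Hypothesis LambdaE : forall A, measurable A -> Lambda A = (n%:R%:E * mu A)%E.
Hypothesis pts_poisson : poisson_point_process P (unit_square R) Lambda pts.

Lemma probability_low_height (kap rho a y1 y2 : R) (l b T m g : nat) :
  0 < kap < 1 -> (1 < b)%N -> (0 < T)%N -> (0 < m)%N ->
  0 < rho -> y1 < y2 ->
  (forall L, size L = (T * b)%N ->
     admissible (expR (- T%:R^-1)) (kap / T%:R) L ->
     2 <= \sum_(0 <= j < b)
       bernoulli_mean L (fun x => (deep_cell b T l 0 b j x)%:R)) ->
  (forall (s : R) c, in_box 0 a y1 y2 c -> has_area s c ->
     rect c `<=` unit_square R /\
     kap * (rho * s) <= fine (mu (rect c)) <= rho * s) ->
  b%:R ^+ g.+1 <= n%:R * rho * ((y2 - y1) / m%:R) * a ->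
  (P [set w | ((height (bst_of_points (pts w))).+1 < g * l)%N] <=
   ((1 - b%:R^-1) ^+ m)%:E)%E.
Proof.
move=> /andP[kap0 kap1] b1 T0 m0 rho0 y12 two dens bg.
have b0 : (0 < b)%N by exact: ltnW.
have nR : 0 < n%:R :> R by rewrite ltr0n.
have mR : 0 < m%:R :> R by rewrite ltr0n.
have bR : 0 < b%:R :> R by rewrite ltr0n.
have TR : 0 < T%:R :> R by rewrite ltr0n.
pose w := (y2 - y1) / m%:R; have w0 : 0 < w by rewrite divr_gt0// subr_gt0.
(* Gives every cell a mean number of points at most [1/T], and at least [kap / T]. *)
pose s := b%:R / (T%:R * n%:R * rho * w).
have s0 : 0 < s.
  by apply: divr_gt0 => //; apply: mulr_gt0 w0; rewrite !mulr_gt0.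
pose F j := strip_cells b T g 0 s (y1 + j%:R * w) w.
pose cells := flatten [seq F j | j <- iota 0 m].
have Fbox j : all (in_box 0 a (y1 + j%:R * w) (y1 + j%:R * w + w)) (F j).
  apply: sub_all (strip_cells_box T g 0 (y1 + j%:R * w) b0 (ltW s0) (ltW w0)).
  move=> c /and4P[tc ct yc cy]; apply/and4P; split=> //.
  apply: le_trans ct _; rewrite add0r.
  apply: le_trans (duration_le T g b1 (ltW s0)) _.
  (* The total duration of the [g] generations; the hypothesis on [g] says that it fits in the time
     [a]. *)
  rewrite (_ : _ * _ = b%:R ^+ g.+1 / (n%:R * rho * w)); last first.
    by rewrite /s exprS; field; rewrite !gt_eqF.
  by rewrite ler_pdivrMr ?(mulr_gt0 (mulr_gt0 nR rho0) w0)// mulrC.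
have cells_box : all (in_box 0 a y1 y2) cells.
  have := flatten_box m (ltW w0) Fbox.
  have -> // : y1 + m%:R * w = y2 by rewrite /w; field; rewrite gt_eqF.
pose area := s * (w / b%:R).
have areaE : n%:R * rho * area = T%:R^-1.
  by rewrite /area /s; field; rewrite !gt_eqF.
have Farea j : all (has_area area) (F j) by exact: strip_cells_area.
have cells_area : all (has_area area) cells.
  apply/allP => c /flattenP[? /mapP[j _ ->] cF]; exact: (allP (Farea j)).
have cells_apart : pairwise apart cells.
  apply: flatten_apart (ltW w0) _ Fbox => j.
  by apply: strip_cells_apart => //; exact: ltW.
have cell_spec c : c \in cells -> rect c `<=` unit_square R /\
    admissible (expR (- T%:R^-1)) (kap / T%:R)
      [:: void_prob Lambda (rect c)].
  move=> cc; have [cS cmu] := dens _ _ (allP cells_box _ cc) (allP cells_area _ cc).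
  split=> //; rewrite /admissible /= andbT.
  apply: admissible_void_prob; [exact: ltW|by rewrite invr_ge0|].
  have mc := measurable_rect c.
  rewrite LambdaE// fineM ?fin_num_measure//=.
  rewrite -areaE; case/andP: cmu => h1 h2; apply/andP; split.
    rewrite (_ : kap * _ = n%:R * (kap * (rho * area))); last by ring.
    by rewrite ler_pM2l.
  by rewrite -mulrA ler_pM2l.
pose void c := void_prob Lambda (rect c).
pose Ls := [seq map void (F j) | j <- iota 0 m].
pose phi (x : seq bool) := all (fun j =>
  ~~ survives b T l g (nth [::] (reshape (shape Ls) x) j)) (iota 0 m).
have shLs : shape Ls = nseq m (sites b T g).
  rewrite (@shape_map_nseq _ _ _ _ (sites b T g)) ?size_iota// => j.
  by rewrite size_map size_strip_cells.
have [||mE PE] := @probability_occupation _ _ _ _ _ _ _ pts_poisson (map rect cells) phi.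
- move=> i; have [isz|szi] := ltnP i (size cells); last first.
    by rewrite nth_default ?size_map//; split.
  rewrite (nth_map ((0, 0), (0, 0)))//; split; first exact: measurable_rect.
  by have [] := cell_spec _ (mem_nth ((0, 0), (0, 0)) isz).
- exact: pairwise_apart_trivIset.
set E := [set w | _] in mE PE.
apply: (@le_trans _ _ (P E)).
  apply: le_measure; rewrite ?inE//.
    exact: (measurable_height pts_poisson [set k | (k.+1 < g * l)%N]).
  move=> w' /=; rewrite ltnNge /E /= => /negP low; apply/allP => j.
  rewrite mem_iota => /andP[_ jm]; apply/negP => sj; apply: low.
  move: sj; rewrite shLs -map_comp /cells map_flatten -map_comp.
  set ss := map _ _; have -> : nseq m (sites b T g) = shape ss.
    rewrite (@shape_map_nseq _ _ _ _ (sites b T g)) ?size_iota// => i.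
    by rewrite size_map size_strip_cells.
  rewrite flattenK (nth_map 0%N) ?size_iota// nth_iota// => sj.
  (* No point has a negative first coordinate, so every strip is clear at time 0. *)
  have [|v _] := survives_depth b0 (ltW s0) w0 _ sj.
    have [ptsS _ _ _] := pts_poisson.
    by move=> p /ptsS[] /=; rewrite in_itv /= => /andP[p0 _] _; rewrite ltNge p0.
  by apply: leq_trans; exact: leq_addl.
rewrite PE lee_fin.
have -> : map (void_prob Lambda) (map rect cells) = flatten Ls.
  by rewrite -map_comp /cells map_flatten -map_comp.
have := @mean_no_survivor R (expR (- T%:R^-1)) (kap / T%:R) b T l g Ls.
rewrite size_map size_iota; apply=> //.
move=> L /mapP[j jm ->]; split; first by rewrite size_map size_strip_cells.
apply/allP => x /mapP[c cF ->].
have [|_] := cell_spec c.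
  by apply/flattenP; exists (F j) => //; apply/mapP; exists j.
by rewrite /admissible /= andbT.
Qed.

End low_height.

(* [g] is such that the integer part of [K n] has [g + 2] digits in base [b]. *)
Lemma generations (R : realType) (K r : R) (b l : nat) :
  0 < K -> 0 <= r -> (1 < b)%N -> r * ln b%:R < l%:R ->
  \forall n \near \oo, exists g,
    b%:R ^+ g.+1 <= K * n%:R /\ r * ln n%:R + 1 < (g * l)%:R :> R.
Proof.
move=> K0 r0 b1 rl.
have bR : 1 < b%:R :> R by rewrite ltr1n.
have bR0 : 0 < b%:R :> R by rewrite (lt_trans ltr01).
have lb : 0 < ln b%:R :> R by exact: ln_gt0.
pose D : R := l%:R - r * ln b%:R; have D0 : 0 < D by rewrite subr_gt0.
(* From [K n < b ^ (g + 2)], [g l ln b] exceeds [l (ln K + ln n) - 2 l ln b]; this is more than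
   [(r ln n + 1) ln b] once [ln n > y]. *)
pose y : R := (ln b%:R + 2 * l%:R * ln b%:R - l%:R * ln K) / D.
near=> n.
have n0 : 0 < n%:R :> R.
  by rewrite ltr0n; near: n; exact: nbhs_infty_gt.
have ny : y < ln n%:R.
  rewrite -ltr_expR lnK ?posrE//; near: n; exact: nbhs_infty_gtr.
have Knb : b%:R <= K * n%:R.
  by rewrite mulrC -ler_pdivrMr//; near: n; exact: nbhs_infty_ger.
have Kn0 : 0 <= K * n%:R by apply: le_trans Knb; exact: ltW.
pose N := Num.truncn (K * n%:R).
have bN : (b <= N)%N by rewrite truncn_ge_nat.
have N0 : (0 < N)%N by rewrite (leq_trans _ bN)// ltnW.
have /andP[qN Nq] := trunc_log_bounds b1 N0.
case: (trunc_log b N) qN Nq => [|g] qN Nq.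
  by rewrite expn1 ltnNge bN in Nq.
exists g; split.
  by rewrite -natrX -truncn_ge_nat.
have Knq : K * n%:R < b%:R ^+ g.+2.
  by apply: lt_le_trans (truncnS_gt _) _; rewrite -natrX ler_nat.
have : ln (K * n%:R) < ln (b%:R ^+ g.+2 : R).
  by rewrite ltr_ln ?posrE ?exprn_gt0 ?mulr_gt0.
have -> : ln (b%:R ^+ g.+2) = (g%:R + 1 + 1) * ln b%:R :> R.
  by rewrite lnXn// -[LHS]mulr_natl -!natr1.
rewrite lnM ?posrE// => h.
rewrite -(ltr_pM2r lb) natrM.
have : y * D < ln n%:R * D by rewrite ltr_pM2r.
rewrite /y divfK ?gt_eqF// /D => h2.
have h3 : l%:R * (ln K + ln n%:R) <= l%:R * ((g%:R + 1 + 1) * ln b%:R).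
  by rewrite ler_wpM2l// ltW.
lra.
Unshelve. all: by end_near. Qed.

Unset Implicit Arguments.

Theorem proposition5p5 (R : realType) (mu : probability (R * R)%type R)
  (mu_permuton : permuton mu)
  (mu_density : exists y : R, 0 <= y <= 1 /\
    has_continuous_positive_density_near mu (0, y))
  (d : nat -> measure_display) (Omega : forall n, measurableType (d n))
  (P : forall n, probability (Omega n) R)
  (pts : forall n, Omega n -> {fset R * R})
  (pts_poisson : forall n, poisson_point_process (P n) (unit_square R)
    (mscale n%:R%:nng mu) (pts n))
  (c : R) (c_ge2 : 2 <= c) (c_eq : c * ln (2 * expR 1 / c) = 1)
  (eps : R) (eps_gt0 : 0 < eps) :
  (fun n => P n [set w |
     (height (bst_of_points (pts n w)))%:R / (c * ln n%:R) <= 1 - eps])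
    @ \oo --> 0%E.
Proof.
have [y [y01 dens]] := mu_density.
have c0 : 0 < c by apply: lt_le_trans c_ge2.
(* The event shrinks as [eps] grows, so a smaller value below 1 may be used. *)
pose e := Num.min eps 2^-1.
have e01 : 0 < e < 1 by rewrite lt_min gt_min eps_gt0/=; apply/andP; split; lra.
have [kap [l [b [T [kap01 b1 T0 cl two]]]]] := branching_parameters c_ge2 c_eq e01.
have [rho [a [y1 [y2 [rho0 a0 y12 dens']]]]] :=
  density_near_rectangle y01 dens kap01.
have r0 : 0 <= (1 - e) * c by case/andP: e01 => _ e1; rewrite mulr_ge0 ?ltW ?subr_gt0.
pose E n := [set w | (height (bst_of_points (pts n w)))%:R / (c * ln n%:R) <= 1 - eps].
have mE n : measurable (E n).
  exact: (measurable_height (pts_poisson n)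
    [set k | k%:R / (c * ln n%:R) <= 1 - eps]).
apply/fine_cvgP; split; first by apply: nearW => n; exact: fin_num_measure.
apply/cvgrPdist_lt => eta eta0.
have b'1 : `|1 - b%:R^-1| < 1 :> R.
  have : 0 < b%:R^-1 :> R by rewrite invr_gt0 ltr0n ltnW.
  have : b%:R^-1 < 1 :> R by rewrite invf_lt1 ?ltr0n ?ltr1n// ltnW.
  by rewrite ltr_norml; lra.
(* The number of strips is fixed before [n], so their width enters only the constant factor in
   [generations]. *)
have [m [m0 meta]] : exists m, (0 < m)%N /\ (1 - b%:R^-1) ^+ m < eta.
  have /cvgrPdist_lt/(_ _ eta0)[M _ HM] := cvg_expr b'1.
  exists M.+1; split=> //; have := HM M.+1 (leqnSn M).
  by rewrite /= sub0r normrN; apply: le_lt_trans; rewrite ler_norm.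
have mR : 0 < m%:R :> R by rewrite ltr0n.
have K0 : 0 < rho * ((y2 - y1) / m%:R) * a.
  by rewrite !mulr_gt0 ?subr_gt0 ?invr_gt0.
near=> n.
have n1 : (1 < n)%N by near: n; exact: nbhs_infty_gt.
have lnn : 0 < ln n%:R :> R by rewrite ln_gt0 ?ltr1n.
have [g [bg gl]] : exists g, b%:R ^+ g.+1 <= rho * ((y2 - y1) / m%:R) * a * n%:R /\
    (1 - e) * c * ln n%:R + 1 < (g * l)%:R :> R.
  by near: n; exact: generations K0 r0 b1 cl.
rewrite sub0r normrN ger0_norm ?fine_ge0//.
apply: le_lt_trans meta; rewrite -lee_fin fineK ?fin_num_measure//.
have n0 : (0 < n)%N by exact: ltnW.
apply: le_trans (probability_low_height n0 _ (pts_poisson n) kap01 b1 T0 m0 rho0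
  y12 two dens' (g := g) _); last first.
- by rewrite (_ : n%:R * _ * _ * _ = rho * ((y2 - y1) / m%:R) * a * n%:R)//; ring.
- by [].
apply: le_measure; rewrite ?inE//.
  exact: (measurable_height (pts_poisson n) [set k | (k.+1 < g * l)%N]).
move=> w; rewrite /E /= ler_pdivrMr ?mulr_gt0// => hw.
(* The [+ 1] in [generations] absorbs the successor of the height. *)
rewrite -(ltr_nat R) -natr1; apply: le_lt_trans gl; rewrite lerD2r.
apply: le_trans hw _; rewrite -mulrA ler_wpM2r//.
  by rewrite mulr_ge0// ltW.
by rewrite lerD2l lerN2 ge_min lexx.
Unshelve. all: by end_near. Qed.
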